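(* Let $T\in[0,+\infty)$, $\sigma\in\mathbb{R}_+$ and $c\in[1,3)$. Let $(\Omega,\mathcal{F},\{\mathcal{F}_t\}_{t\in[0,T]},\mathbb{P})$ be a filtered probability space, $W$ a one-dimensional Brownian motion on it with respect to $\{\mathcal{F}_t\}_{t\in[0,T]}$, and $\underline{u}$ an $\mathcal{F}_0$-measurable random variable with values in $H_+$. Then the system $$\left\{\begin{array}{ll} du_0=-u_0u_1\,dt+\sigma\, dW(t) & \\ du_j=\left(-2^{cj}u_ju_{j+1}+2^{c(j-1)}u_{j-1}^2\right)dt & \text{for } j\ge 1\\ u(0)=\underline{u} & \end{array}\right.\qquad t\in[0,T],$$ admits a unique strong solution $u$.
   Context: Sequences $u=(u_j)_{j\ge0}$ are real and indexed by $j\ge 0$; $\ell^2$ is the space of square-summable ones. $H_+=\{u\in\ell^2: u_j\ge 0 \text{ for all } j\ge1\}$ (no sign condition on $u_0$). $\mathbb{R}_+=[0,\infty)$. The first equation of the system is understood as $u_0(t)=u_0(0)-\int_0^t u_1(s)u_0(s)\,ds+\sigma W(t)$ a.s. Strong solution: given a filtered probability space $(\Omega,\mathcal{F},\{\mathcal{F}_t\}_{t\in[0,T]},\mathbb{P})$, a Brownian motion $W$ with respect to $\{\mathcal{F}_t\}$ and an $\mathcal{F}_0$-measurable initial condition $\underline{u}$, a strong solution is a stochastic process $u$ on $(\Omega,\mathcal{F},\mathbb{P})$ with continuous sample paths, satisfying the system and adapted to the filtration generated by $W$ and $\underline{u}$. Here the paths are as in the pathwise notion of solution: each component $t\mapsto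 u_j(t)$ is continuous on $[0,T]$ and $u(t)\in H_+$ for all $t\in[0,T]$. Uniqueness: the strong solution is unique if any two solutions $u^{(1)},u^{(2)}$ with the same initial condition satisfy $u^{(1)}(t)=u^{(2)}(t)$ for all $t\in[0,T]$ a.s. *)

(* Defs.v *)
From HB Require Import structures.
From mathcomp Require Import all_boot all_order all_algebra.
From mathcomp Require Import all_classical all_reals all_analysis.

Set Implicit Arguments.
Unset Strict Implicit.
Unset Printing Implicit Defensive.

Import Order.TTheory GRing.Theory Num.Theory.
Import numFieldNormedType.Exports.

Local Open Scope classical_set_scope.
Local Open Scope ring_scope.

Section SequenceSpace.
Variable R : realType.

Definition l2 : set (nat -> R) :=
  [set v : nat -> R | cvgn (series (fun j => v j ^+ 2))].

Definition l2_norm (v : nat -> R) : R :=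
  Num.sqrt (limn (series (fun j => v j ^+ 2))).

Definition Hplus : set (nat -> R) :=
  [set v : nat -> R | l2 v /\ forall j : nat, (1 <= j)%N -> 0 <= v j].

Definition l2_open : set (set (nat -> R)) :=
  [set A : set (nat -> R) | A `<=` l2 /\
    forall v, A v -> exists2 e : R, 0 < e &
      forall v', l2 v' -> l2_norm (fun j => v' j - v j) < e -> A v'].

(* The norm topology is the one intended here, not the product topology that
   the library puts on [nat -> R]; complements are relative to [l2]. *)
Definition l2_borel : set (set (nat -> R)) := <<s l2, l2_open >>.

Definition R_borel : set (set R) :=
  [set B | measurable (B : set (measurableTypeR R))].

End SequenceSpace.

Arguments l2_borel : clear implicits.
Arguments R_borel : clear implicits.

(* [X] is a map into a space with sigma-algebra [E]; [G] is a sub-sigma-algebra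
   on the source, which need not be the ambient one. *)
Definition measurable_wrt (Omega S : Type) (G : set (set Omega))
    (E : set (set S)) (X : Omega -> S) : Prop :=
  forall A, E A -> G (X @^-1` A).

Section Processes.
Variables (R : realType) (d : measure_display) (Omega : measurableType d).
Variables (P : probability Omega R) (T : R).

Definition is_filtration (F : R -> set (set Omega)) : Prop :=
  [/\ forall t : R, 0 <= t <= T -> sigma_algebra setT (F t),
      forall t : R, 0 <= t <= T -> F t `<=` measurable &
      forall s t : R, 0 <= s -> s <= t -> t <= T -> F s `<=` F t].

(* [normal_prob] takes the standard deviation as its second parameter. *)
Record is_brownian_motion (F : R -> set (set Omega)) (W : R -> Omega -> R)
    : Prop := {
  bm_adapted : forall t : R, 0 <= t <= T -> measurable_wrt (F t) (R_borel R) (W t) ;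
  bm_continuous : forall w, {within `[0, T], continuous (fun t => W t w)} ;
  bm_start : {ae P, forall w, W 0 w = 0} ;
  bm_normal : forall s t : R, 0 <= s -> s < t -> t <= T ->
    forall B, R_borel R B ->
      P ((W t \- W s) @^-1` B) =
      normal_prob (0 : R) (Num.sqrt (t - s)) B ;
  bm_indep : forall s t : R, 0 <= s -> s < t -> t <= T ->
    forall A B, F s A -> R_borel R B ->
      P (A `&` ((W t \- W s) @^-1` B)) =
      (P A * P ((W t \- W s)%R @^-1` B))%E }.

Definition generated_filtration (W : R -> Omega -> R)
    (u0 : Omega -> nat -> R) (t : R) : set (set Omega) :=
  <<s preimage_set_system setT u0 (l2_borel R) `|`
      \bigcup_(s in `[0, t]) preimage_set_system setT (W s) (R_borel R) >>.

Definition drift (c : R) (v : nat -> R) (j : nat) : R :=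
  if j is i.+1 then
    - (2 `^ (c * j%:R) * v j * v j.+1) + 2 `^ (c * i%:R) * v i ^+ 2
  else - (v 0%N * v 1%N).

Definition satisfies_system (sigma c : R) (W : R -> Omega -> R)
    (u0 : Omega -> nat -> R) (u : R -> Omega -> nat -> R) (w : Omega) : Prop :=
  u 0 w = u0 w /\
  forall t : R, 0 <= t <= T ->
    u t w 0%N = u 0 w 0%N
      + (\int[lebesgue_measure]_(s in `[0, t]) drift c (u s w) 0%N)
      + sigma * W t w /\
    forall j : nat, (1 <= j)%N ->
      u t w j = u 0 w j
        + (\int[lebesgue_measure]_(s in `[0, t]) drift c (u s w) j).

Record strong_solution (sigma c : R) (W : R -> Omega -> R)
    (u0 : Omega -> nat -> R) (u : R -> Omega -> nat -> R) : Prop := {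
  sol_Hplus : forall w (t : R), 0 <= t <= T -> Hplus (u t w) ;
  sol_continuous : forall w j, {within `[0, T], continuous (fun t => u t w j)} ;
  sol_adapted : forall t : R, 0 <= t <= T ->
    measurable_wrt (generated_filtration W u0 t) (l2_borel R) (u t) ;
  sol_system : {ae P, forall w, satisfies_system sigma c W u0 u w} }.

End Processes.

(* Main.v *)
Require Import Defs.
From HB Require Import structures.
From mathcomp Require Import all_boot all_order all_algebra.
From mathcomp Require Import all_classical all_reals all_analysis.
From mathcomp Require Import measurable_realfun.
From mathcomp Require Import ring lra.
Set Implicit Arguments.
Unset Strict Implicit.
Unset Printing Implicit Defensive.
Import Order.TTheory GRing.Theory Num.Theory.
Import numFieldNormedType.Exports.
Local Open Scope classical_set_scope.
Local Open Scope ring_scope.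

(** The system is solved path by path. Fix a continuous path w with w(0) = 0 and
an initial state x in H+, put k_j = q^j with q = 2^c, and write the j-th
equation as u_j' = k_{j-1} u_{j-1}^2 - k_j u_j u_{j+1}; the noise enters the
mode 0 only, so the modes j >= 1 are differentiable and the difference of two
solutions driven by the same path is differentiable in every mode.

Estimates ([energy_le], [cubic_bounded], [difference_le]). The sum of u_j^2 over
1 <= j <= n changes by the inflow 2 u_0^2 u_1 and the outflow 2 k_n u_n^2 u_{n+1}.
Since u_1 grows at most at rate u_0^2, the energy and the integrals of the fluxes
k_n u_n^2 u_{n+1} over [0, T] are bounded uniformly in n. Differentiating
u_n u_{n+1} produces the term k_n u_n^3; controlling the other terms by Young's
inequality, with a small weight on cubes and a large one on fluxes, gives
  G_n <= C + (q G_n + G_{n+1} + G_{n+2}) / l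
for G_n, the integral of k_n u_n^3, where l = 6 q^2 is as large as needed. As G_n
grows at most like k_n, this forces G_n <= 2 C for all n >= 1
([recurrence_bound]). Finally, for the difference z of two solutions u and v the
weights 2^-j make the cross terms z_j z_{j+1} telescope, and positivity leaves a
boundary term only:
  sum_{j <= n} 2^-j z_j(t)^2
    <= 2^-n times the integral of k_n (v_n^2 u_{n+1} + u_n^2 v_{n+1}),
and a^2 b <= a^3 + b^3 bounds the right-hand side by a constant times 2^-n.

Uniqueness ([pathwise_unique]) follows by letting n tend to infinity.

Existence ([limit_sol_eq], [limit_sol_Hplus]). The system is truncated at level N
with the closure u_{N+1} = u_N, which dissipates energy, so that the same bounds
hold uniformly in N, up to the last mode. The difference estimate then shows that
the truncated solutions form a Cauchy sequence, uniformly on [0, T] in each mode: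
no compactness argument is needed, and the limit solves the system. The truncated
systems are finite-dimensional; they are solved by Picard iteration after their
coefficients are clamped to the box of size N, and the clamping is inactive as
soon as N exceeds the a priori bounds of the path ([galerkin_solves]).

Adaptedness ([strong_sol_adapted]). Every object above is a pointwise limit of
explicit measurable functions of x and of the values of w before time t, an
integral being a limit of Riemann sums. A map with values in l2 whose coordinates
are measurable is measurable for the Borel sets of the norm, because l2 is
separable ([measurable_l2_borel]). *)

(** * Primitives of continuous functions on [0, T] *)

Section Calculus.
Context {R : realType}.
Implicit Types (T t s e : R) (f g F G : R -> R).

(** [f] is continuous on [0, T]; its values outside [0, T] are irrelevant. *)
Definition cont_on T f := {within `[0, T], continuous f}.

(** The integral of [f] over [0, t]; it is 0 for t < 0, the interval being empty. *)
Definition primitive0 f t : R := \int[lebesgue_measure]_(s in `[0, t]) f s.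

Lemma cont_onP T f : cont_on T f <->
  forall t, 0 <= t <= T -> forall e, 0 < e ->
    exists2 d : R, 0 < d & forall s, 0 <= s <= T -> `|t - s| < d ->
      `|f t - f s| < e.
Proof.
split=> [/subspace_continuousP cf t tT e e0|cf].
  have /cf/cvgrPdist_lt/(_ e e0) : [set` `[0, T]] t by rewrite /= in_itv.
  rewrite near_withinE => -[d /= d0 H]; exists d => // s sT ts.
  by apply: H => //=; rewrite in_itv.
apply/subspace_continuousP => t /=; rewrite in_itv/= => tT.
apply/cvgrPdist_lt => e e0; have [d d0 H] := cf t tT e e0.
rewrite near_withinE; exists d => //= s ts; rewrite in_itv/= => sT.
exact: H.
Qed.

Lemma cont_onW T t f : t <= T -> cont_on T f -> cont_on t f.
Proof.
move=> tT; apply: continuous_subspaceW => s /=; rewrite !in_itv/=.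
by move=> /andP[-> /le_trans]; apply.
Qed.

Lemma eq_cont_on T f g : (forall t, 0 <= t <= T -> f t = g t) ->
  cont_on T f -> cont_on T g.
Proof.
move=> fg /cont_onP cf; apply/cont_onP => t tT e e0.
have [d d0 H] := cf t tT e e0; exists d => // s sT.
by rewrite -!fg//; exact: H.
Qed.

Lemma cont_on_cst T (a : R) : cont_on T (fun=> a).
Proof. by move=> x; exact: cst_continuous. Qed.
Arguments cont_on_cst : clear implicits.

Lemma cont_onD T f g : cont_on T f -> cont_on T g ->
  cont_on T (fun t => f t + g t).
Proof. by move=> cf cg x; apply: continuousD; [exact: cf|exact: cg]. Qed.

Lemma cont_onN T f : cont_on T f -> cont_on T (fun t => - f t).
Proof. by move=> cf x; apply: continuousN; exact: cf. Qed.

Lemma cont_onB T f g : cont_on T f -> cont_on T g ->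
  cont_on T (fun t => f t - g t).
Proof. by move=> cf cg; apply: cont_onD => //; exact: cont_onN. Qed.

Lemma cont_onM T f g : cont_on T f -> cont_on T g ->
  cont_on T (fun t => f t * g t).
Proof. by move=> cf cg x; apply: continuousM; [exact: cf|exact: cg]. Qed.

Lemma cont_onZ T (a : R) f : cont_on T f -> cont_on T (fun t => a * f t).
Proof. by move=> cf; apply: cont_onM => //; exact: cont_on_cst. Qed.

Arguments cont_onZ {T} a {f}.

Lemma cont_onX T f n : cont_on T f -> cont_on T (fun t => f t ^+ n).
Proof.
move=> cf; elim: n => [|n IH].
  by apply: (eq_cont_on (f := fun=> 1) _ (cont_on_cst T _)) => t _; rewrite expr0.
by apply: (eq_cont_on (f := fun t => f t * f t ^+ n) _ (cont_onM cf IH)) => t _; rewrite exprS.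
Qed.

Lemma cont_on_sum T (F : nat -> R -> R) m n :
  (forall j, (m <= j < n)%N -> cont_on T (F j)) ->
  cont_on T (fun t => \sum_(m <= j < n) F j t).
Proof.
elim: n => [_|n IH cF].
  by apply: (eq_cont_on (f := fun=> 0) _ (cont_on_cst T _)) => t _; rewrite big_geq.
case: (leqP m n) => mn; last first.
  by apply: (eq_cont_on (f := fun=> 0) _ (cont_on_cst T _)) => t _; rewrite big_geq.
apply: (eq_cont_on (f := fun t => \sum_(m <= j < n) F j t + F n t)).
  by move=> t _; rewrite big_nat_recr.
apply: cont_onD; last by apply: cF; rewrite mn /=.
by apply: IH => j /andP[mj jn]; apply: cF; rewrite mj ltnW.
Qed.

Lemma cont_on_integrable T f t : cont_on T f -> t <= T ->
  lebesgue_measure.-integrable `[0, t] (EFin \o f).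
Proof.
move=> cf tT; apply: continuous_compact_integrable; first exact: segment_compact.
exact: cont_onW cf.
Qed.

Lemma primitive0_0 f : primitive0 f 0 = 0.
Proof. by rewrite /primitive0 set_itv1 Rintegral_set1. Qed.

Lemma eq_primitive0 f g t : (forall s, 0 <= s <= t -> f s = g s) ->
  primitive0 f t = primitive0 g t.
Proof.
by move=> fg; apply: eq_Rintegral => s; rewrite inE/= in_itv/=; exact: fg.
Qed.

Lemma primitive0D T f g t : cont_on T f -> cont_on T g -> t <= T ->
  primitive0 (fun s => f s + g s) t = primitive0 f t + primitive0 g t.
Proof.
by move=> cf cg tT; rewrite /primitive0 RintegralD//; exact: cont_on_integrable.
Qed.

Lemma primitive0Z T (a : R) f t : cont_on T f -> t <= T ->
  primitive0 (fun s => a * f s) t = a * primitive0 f t.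
Proof.
by move=> cf tT; rewrite /primitive0 RintegralZl//; exact: cont_on_integrable.
Qed.

Lemma primitive0B T f g t : cont_on T f -> cont_on T g -> t <= T ->
  primitive0 (fun s => f s - g s) t = primitive0 f t - primitive0 g t.
Proof.
by move=> cf cg tT; rewrite /primitive0 RintegralB//; exact: cont_on_integrable.
Qed.

Lemma le_primitive0 T f g t : cont_on T f -> cont_on T g -> t <= T ->
  (forall s, 0 <= s <= t -> f s <= g s) -> primitive0 f t <= primitive0 g t.
Proof.
move=> cf cg tT fg; apply: le_Rintegral => //; try by apply: cont_on_integrable tT.
Qed.

Lemma primitive0_cst (a : R) t : 0 <= t -> primitive0 (fun=> a) t = a * t.
Proof.
move=> t0; rewrite /primitive0 Rintegral_cst//= lebesgue_measure_itv/= lte_fin.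
case: ltgtP t0 => // [t0 _|<- _]; first by rewrite oppr0 adde0.
by rewrite mulr0.
Qed.

Lemma primitive0_ge0 f t : (forall s, 0 <= s <= t -> 0 <= f s) ->
  0 <= primitive0 f t.
Proof. by move=> f0; apply: Rintegral_ge0 => s /=; rewrite in_itv/=; exact: f0. Qed.

Lemma cont_on_primitive0 T f : 0 <= T -> cont_on T f -> cont_on T (primitive0 f).
Proof.
move=> T0 cf; apply: parameterized_integral_continuous => //.
exact: cont_on_integrable.
Qed.

Lemma cont_on_at T f t : cont_on T f -> 0 < t < T -> {for t, continuous f}.
Proof.
move=> cf tT; have /andP[t0 tT'] := tT.
have /(continuous_within_itvP f (lt_trans t0 tT'))[+ _ _] := cf.
by move/(_ t); rewrite in_itv/=; apply.
Qed.

Lemma is_derive_primitive0 T f t : cont_on T f -> 0 < t < T ->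
  is_derive t 1 (primitive0 f) (f t).
Proof.
move=> cf tT; have /andP[t0 tT'] := tT.
have [|d1 d2] := @continuous_FTC1_closed _ f 0 t T tT' _ t0 (cont_on_at cf tT).
  exact: cont_on_integrable cf _.
rewrite -d2 derive1E; exact/derivableP.
Qed.

(** [F] is a primitive on [0, T] of the continuous function [f], in the integral
form; by [prim_derive] and [derive_prim] this amounts to F' = f on ]0, T[. *)
Definition prim T F f :=
  [/\ cont_on T F, cont_on T f &
      forall t, 0 <= t <= T -> F t = F 0 + primitive0 f t].

Lemma primW T t F f : t <= T -> prim T F f -> prim t F f.
Proof.
move=> tT [cF cf H]; split; [exact: cont_onW cF|exact: cont_onW cf|].
by move=> s /andP[s0 st]; apply: H; rewrite s0 (le_trans st).
Qed.

Lemma prim_primitive0 T f : 0 <= T -> cont_on T f -> prim T (primitive0 f) f.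
Proof.
move=> T0 cf; split => //; first exact: cont_on_primitive0.
by move=> t _; rewrite primitive0_0 add0r.
Qed.

Lemma prim_derive T F f t : prim T F f -> 0 < t < T -> is_derive t 1 F (f t).
Proof.
move=> [cF cf H] tT; have /andP[t0 tT'] := tT.
have dI := is_derive_primitive0 cf tT.
suff : is_derive t 1 (cst (F 0) + primitive0 f) (0 + f t).
  rewrite add0r; apply: near_eq_is_derive.
  near=> s; rewrite [RHS]H//.
  apply/andP; split; apply/ltW; near: s; [exact: lt_nbhsr|exact: lt_nbhsl].
exact: is_deriveD.
Unshelve. all: by end_near. Qed.

Lemma prim_mono T F f s t : prim T F f -> 0 <= s -> s <= t -> t <= T ->
  (forall r, s < r < t -> 0 <= f r) -> F s <= F t.
Proof.
move=> pF s0; rewrite le_eqVlt => /predU1P[->//|st] tT f0.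
have [||r] := @MVT R F f s t st.
- move=> r; rewrite in_itv/= => /andP[sr rt]; apply: (prim_derive pF).
  by rewrite (le_lt_trans s0 sr) (lt_le_trans rt tT).
- have [cF _ _] := pF; apply: continuous_subspaceW cF => r /=; rewrite !in_itv/=.
  by move=> /andP[sr rt]; rewrite (le_trans s0 sr) (le_trans rt tT).
rewrite in_itv/= => rst /eqP; rewrite subr_eq => /eqP ->.
by rewrite lerDr mulr_ge0 ?f0// subr_ge0 ltW.
Qed.

Lemma derive_prim T F f : cont_on T F -> cont_on T f ->
  (forall t, 0 < t < T -> is_derive t 1 F (f t)) -> prim T F f.
Proof.
move=> cF cf dF; split => // t /andP[t0 tT].
move: t0; rewrite le_eqVlt => /predU1P[<-|t0]; first by rewrite primitive0_0 addr0.
have T0 : 0 <= T by rewrite (le_trans _ tT)// ltW.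
have [||r] := @MVT R (F - primitive0 f) (fun=> 0) 0 t t0.
- move=> r; rewrite in_itv/= => /andP[r0 rt].
  have rT : 0 < r < T by rewrite r0 (lt_le_trans rt tT).
  rewrite -(subrr (f r)); apply: is_deriveB; first exact: dF.
  exact: is_derive_primitive0 cf rT.
- apply: (cont_onW tT); apply: (cont_onB cF); exact: cont_on_primitive0.
move=> _; rewrite mul0r => /eqP; rewrite subr_eq0 => /eqP.
rewrite -[LHS]/(F t - primitive0 f t) -[RHS]/(F 0 - primitive0 f 0).
by rewrite primitive0_0 subr0 => <-; rewrite subrK.
Qed.

Lemma eq_prim T F f G g : (forall t, 0 <= t <= T -> F t = G t) ->
  (forall t, 0 <= t <= T -> f t = g t) -> prim T F f -> prim T G g.
Proof.
move=> FG fg [cF cf H]; split; [exact: eq_cont_on cF|exact: eq_cont_on cf|].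
move=> t tT; have /andP[t0 t1] := tT.
rewrite -FG// -FG ?lexx ?(le_trans t0)// H//; congr (_ + _).
by apply: eq_primitive0 => s /andP[s0 st]; rewrite fg// s0 (le_trans st).
Qed.

Lemma prim_cst T (a : R) : prim T (fun=> a) (fun=> 0).
Proof.
split; [exact: cont_on_cst|exact: cont_on_cst|].
by move=> t /andP[t0 _]; rewrite primitive0_cst// mul0r addr0.
Qed.

Lemma primD T F f G g : prim T F f -> prim T G g ->
  prim T (fun t => F t + G t) (fun t => f t + g t).
Proof.
move=> [cF cf HF] [cG cg HG]; split; [exact: cont_onD|exact: cont_onD|].
move=> t tT; have /andP[t0 t1] := tT.
by rewrite (primitive0D cf cg)// HF// HG// addrACA.
Qed.

Lemma primZ T (a : R) F f : prim T F f ->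
  prim T (fun t => a * F t) (fun t => a * f t).
Proof.
move=> [cF cf HF]; split; [exact: cont_onZ|exact: cont_onZ|].
move=> t tT; have /andP[t0 t1] := tT.
by rewrite (primitive0Z a cf)// HF// mulrDr.
Qed.

Lemma primB T F f G g : prim T F f -> prim T G g ->
  prim T (fun t => F t - G t) (fun t => f t - g t).
Proof.
move=> [cF cf HF] [cG cg HG]; split; [exact: cont_onB|exact: cont_onB|].
move=> t tT; have /andP[t0 t1] := tT.
by rewrite (primitive0B cf cg)// HF// HG// opprD addrACA.
Qed.

Lemma primM T F f G g : prim T F f -> prim T G g ->
  prim T (fun t => F t * G t) (fun t => f t * G t + F t * g t).
Proof.
move=> pF pG; have [cF cf _] := pF; have [cG cg _] := pG.
apply: derive_prim; first exact: cont_onM.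
  by apply: cont_onD; exact: cont_onM.
move=> t tT; have dF := prim_derive pF tT; have dG := prim_derive pG tT.
apply: is_derive_eq; rewrite /GRing.scale/= addrC; congr (_ + _).
by rewrite mulrC.
Qed.

Lemma prim_sqr T F f : prim T F f ->
  prim T (fun t => F t ^+ 2) (fun t => 2 * F t * f t).
Proof.
move=> pF; apply: eq_prim (primM pF pF) => t _; first by rewrite expr2.
by rewrite -mulrA mulr_natl mulr2n [f t * _]mulrC.
Qed.

Lemma prim_sum T (F f : nat -> R -> R) m n :
  (forall j, (m <= j < n)%N -> prim T (F j) (f j)) ->
  prim T (fun t => \sum_(m <= j < n) F j t) (fun t => \sum_(m <= j < n) f j t).
Proof.
elim: n => [_|n IH pF].
  by apply: eq_prim (prim_cst T 0) => t _; rewrite big_geq.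
case: (leqP m n) => mn; last first.
  by apply: eq_prim (prim_cst T 0) => t _; rewrite big_geq.
apply: (eq_prim (F := fun t => \sum_(m <= j < n) F j t + F n t)
                 (f := fun t => \sum_(m <= j < n) f j t + f n t)).
- by move=> t _; rewrite big_nat_recr.
- by move=> t _; rewrite big_nat_recr.
apply: primD; last by apply: pF; rewrite mn /=.
by apply: IH => j /andP[mj jn]; apply: pF; rewrite mj ltnW.
Qed.

Lemma prim_le T F f g t : prim T F f -> cont_on T g -> 0 <= t <= T ->
  (forall s, 0 <= s <= t -> f s <= g s) -> F t <= F 0 + primitive0 g t.
Proof.
move=> [_ cf HF] cg tT fg; have /andP[_ tT'] := tT.
by rewrite HF// lerD2l (le_primitive0 cf cg).
Qed.

Lemma primitive0_nondecreasing T f s t : cont_on T f -> 0 <= s -> s <= t -> t <= T ->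
  (forall r, 0 <= r <= T -> 0 <= f r) -> primitive0 f s <= primitive0 f t.
Proof.
move=> cf s0 st tT f0.
apply: (prim_mono (prim_primitive0 (le_trans s0 (le_trans st tT)) cf)) => // r.
by move=> /andP[sr rt]; rewrite f0// (le_trans s0 (ltW sr)) (le_trans (ltW rt)).
Qed.

Lemma primitive0_dist_le T f g h t : cont_on T f -> cont_on T g -> cont_on T h ->
  0 <= t <= T -> (forall s, 0 <= s <= t -> `|f s - g s| <= h s) ->
  `|primitive0 f t - primitive0 g t| <= primitive0 h t.
Proof.
move=> cf cg ch /andP[t0 tT] fg; rewrite -(primitive0B cf cg)//.
have cfg := cont_onB cf cg; have cNh := cont_onZ (-1) ch.
rewrite ler_norml; apply/andP; split.
  rewrite -mulN1r -(primitive0Z (-1) ch)//.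
  apply: (le_primitive0 cNh cfg) => // s sT.
  by have := fg s sT; rewrite mulN1r ler_norml => /andP[].
apply: (le_primitive0 cfg ch) => // s sT.
by have := fg s sT; rewrite ler_norml => /andP[].
Qed.

Lemma primitive0_dist T f g e t : cont_on T f -> cont_on T g -> 0 <= t <= T ->
  (forall s, 0 <= s <= t -> `|f s - g s| <= e) ->
  `|primitive0 f t - primitive0 g t| <= e * t.
Proof.
move=> cf cg tT fg; have /andP[t0 _] := tT.
by rewrite -primitive0_cst//; apply: (primitive0_dist_le cf cg (cont_on_cst T e)).
Qed.

End Calculus.
Arguments cont_on_cst {R} T a.
Arguments prim_cst {R} T a.
Arguments cont_onZ {R T} a {f}.
Arguments primZ {R T} a {F f}.

(** * Continuous induction and barriers *)

Section Induction.
Context {R : realType}.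
Implicit Types (T t s e a : R) (f g F G : R -> R).

(** Induction on the real interval [0, T]: if, whenever [Q] holds before [s], it holds
on some [s, s + d[, then it holds everywhere. The case s = 0 is the base case. *)
Lemma real_induction T (Q : R -> Prop) :
  (forall s, 0 <= s <= T -> (forall r, 0 <= r < s -> Q r) ->
    exists2 d : R, 0 < d & forall r, r <= T -> s <= r < s + d -> Q r) ->
  forall t, 0 <= t <= T -> Q t.
Proof.
move=> step t1 /andP[t10 t1T]; apply: contrapT => nQ.
pose E := [set s | 0 <= s <= t1 /\ forall r, 0 <= r < s -> Q r].
have E0 : E 0.
  by split; [rewrite lexx|move=> r /andP[r0 /(le_lt_trans r0)]; rewrite ltxx].
have hE : has_sup E by split; [exists 0|exists t1 => s [/andP[]]].
have s0 : 0 <= sup E by apply: ub_le_sup => //; have [] := hE.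
have s1 : sup E <= t1 by apply: ge_sup; [exists 0|move=> s [/andP[]]].
have Qs r : 0 <= r < sup E -> Q r.
  move=> /andP[r0 rs]; have e0 : 0 < sup E - r by rewrite subr_gt0.
  have [s [_ sQ]] := sup_adherent e0 hE.
  by rewrite subKr => ?; apply: sQ; rewrite r0.
have [|d d0 H] := step (sup E) _ Qs; first by rewrite s0 (le_trans s1).
have [t1d|dt1] := ltP t1 (sup E + d); first by apply: nQ; apply: H; rewrite ?s1.
suff : sup E + d <= sup E by rewrite gerDl leNgt d0.
apply: ub_le_sup; first by have [] := hE.
split; first by rewrite dt1 addr_ge0// ltW.
move=> r /andP[r0 rd]; have [rs|sr] := ltP r (sup E); first by apply: Qs; rewrite r0.
by apply: H; [rewrite (le_trans (ltW rd))// (le_trans dt1)|rewrite sr].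
Qed.

(** A continuous function that starts strictly below the level [a] stays strictly
below it if f <= a on [0, t] implies f t < a, for every t. *)
Lemma first_time T f a : cont_on T f -> f 0 < a ->
  (forall t, 0 <= t <= T -> (forall s, 0 <= s <= t -> f s <= a) -> f t < a) ->
  forall t, 0 <= t <= T -> f t < a.
Proof.
move=> /cont_onP cf f0a step; apply: real_induction => s sT fs.
have /andP[s0 sT'] := sT.
have fsa : f s < a.
  apply: step => // r /andP[r0]; rewrite le_eqVlt => /predU1P[->|rs]; last first.
    by apply/ltW/fs; rewrite r0.
  rewrite leNgt; apply/negP => afs.
  have [s00|s00] := eqVneq s 0; first by move: afs; rewrite s00 ltNge (ltW f0a).
  have sp : 0 < s by rewrite lt_neqAle eq_sym s00.
  have [d d0 H] := cf s sT (f s - a) ltac:(by rewrite subr_gt0).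
  have m0 : 0 < Num.min d s by rewrite lt_min d0.
  have md : Num.min d s <= d by rewrite ge_min lexx.
  have ms : Num.min d s <= s by rewrite ge_min lexx orbT.
  pose r' := s - Num.min d s / 2.
  have r'0 : 0 <= r' by rewrite /r'; lra.
  have r's : r' < s by rewrite /r'; lra.
  have : f r' < a by apply: fs; rewrite r'0.
  have : `|f s - f r'| < f s - a.
    apply: H; first by rewrite r'0 (le_trans (ltW r's)).
    by rewrite /r' subKr gtr0_norm ?divr_gt0//; lra.
  by move=> /(le_lt_trans (ler_norm _)); rewrite ltrD2l ltrN2 => /ltW; rewrite leNgt => /negP.
have [d d0 H] := cf s sT (a - f s) ltac:(by rewrite subr_gt0).
exists d => // r rT /andP[sr rd].
have : `|f s - f r| < a - f s.
  apply: H; first by rewrite rT (le_trans s0).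
  by rewrite distrC ger0_norm ?subr_ge0// ltrBlDl.
by rewrite distrC => /(le_lt_trans (ler_norm _)); rewrite ltrD2r.
Qed.

(** A function that is nondecreasing whenever it lies below the level [a] does not
cross [a] downwards. The proof runs [first_time] backwards from a point where the
function would be below [a]. *)
Lemma barrier T F f a : prim T F f -> a <= F 0 ->
  (forall t, 0 <= t <= T -> F t <= a -> 0 <= f t) ->
  forall t, 0 <= t <= T -> a <= F t.
Proof.
move=> pF aF0 fa t /andP[t0 tT]; rewrite leNgt; apply/negP => Fta.
have [cF cf _] := pF.
suff : F (t - t) < a by rewrite subrr ltNge aF0.
apply: (@first_time t (fun s => F (t - s)) a); rewrite ?subr0 ?lexx ?t0//.
  apply/cont_onP => s /andP[s0 st] e e0.
  have [|d d0 H] := (cont_onP _ _).1 cF (t - s) _ e e0.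
    by rewrite subr_ge0 st (le_trans _ tT)// lerBlDr lerDl.
  exists d => // r /andP[r0 rt] sr; apply: H.
    by rewrite subr_ge0 rt (le_trans _ tT)// lerBlDr lerDl.
  by rewrite opprB addrCA addrAC subrr add0r -opprB normrN.
move=> s /andP[s0 st] Fs; apply: le_lt_trans Fta.
apply: (prim_mono pF) => //; first by rewrite subr_ge0.
  by rewrite lerBlDr lerDl.
move=> r /andP[sr rt]; have r0 : 0 <= r by rewrite (le_trans _ (ltW sr))// subr_ge0.
apply: fa; first by rewrite r0 (le_trans (ltW rt)).
have -> : r = t - (t - r) by rewrite subKr.
by apply: Fs; rewrite subr_ge0 (ltW rt) lerBlDr -lerBlDl ltW.
Qed.

Lemma unif_cont T f e : cont_on T f -> 0 < e -> 0 <= T ->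
  exists2 d : R, 0 < d & forall s r, 0 <= s <= T -> 0 <= r <= T ->
    `|s - r| < d -> `|f s - f r| < e.
Proof.
move=> /cont_onP cf e0 T0.
suff : forall t, 0 <= t <= T -> exists2 d : R, 0 < d & forall s r,
    0 <= s <= t -> 0 <= r <= t -> `|s - r| < d -> `|f s - f r| < e.
  by move=> /(_ T); rewrite T0 lexx; apply.
apply: real_induction => s sT IH.
have [d d0 H] := cf s sT (e / 2) ltac:(by rewrite divr_gt0).
have /andP[s0 sT'] := sT.
have near_s x y : 0 <= x <= T -> 0 <= y <= T -> `|s - x| < d -> `|s - y| < d ->
    `|f x - f y| < e.
  move=> xT yT sx sy; rewrite (splitr e) -(subrKA (f s)) (le_lt_trans (ler_normD _ _))//.
  by rewrite ltrD// ?H// distrC H.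
have [d1 d10 H1] : exists2 d1 : R, 0 < d1 & forall x y, 0 <= x <= s - d / 2 ->
    0 <= y <= s - d / 2 -> `|x - y| < d1 -> `|f x - f y| < e.
  have [sd|sd] := ltP (s - d / 2) 0.
    by exists 1 => // x y /andP[x0 /(le_trans x0)]; rewrite leNgt sd.
  by apply: IH; rewrite sd/= ltrBlDr ltrDl divr_gt0.
exists (d / 2); first by rewrite divr_gt0.
move=> t tT /andP[st td]; exists (Num.min d1 (d / 2)).
  by rewrite lt_min d10 divr_gt0.
move=> x y /andP[x0 xt] /andP[y0 yt]; rewrite lt_min => /andP[xy1 xy2].
have [xs|xs] := leP x (s - d / 2); have [ys|ys] := leP y (s - d / 2).
- by apply: H1; rewrite ?x0 ?y0.
all: by apply: near_s; rewrite ?x0 ?y0 ?(le_trans xt) ?(le_trans yt)//;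
  move: xy2; rewrite !ltr_norml; lra.
Qed.

Lemma cont_on_bounded T f : 0 <= T -> cont_on T f ->
  exists2 B : R, 0 <= B & forall t, 0 <= t <= T -> `|f t| <= B.
Proof.
move=> T0 cf.
have [x _ Hx] := EVT_max T0 cf; have [y _ Hy] := EVT_min T0 cf.
exists (`|f x| + `|f y|) => [|t tT]; first by rewrite addr_ge0.
have tT' : t \in `[0, T]%R by rewrite in_itv.
rewrite ler_norml; apply/andP; split.
  by rewrite (le_trans _ (Hy t tT'))// lerNl (le_trans (ler_norm _))// normrN lerDr.
by rewrite (le_trans (Hx t tT'))// (le_trans (ler_norm _))// lerDl.
Qed.

Lemma riemann_sum T f : 0 <= T -> cont_on T f ->
  (fun n => \sum_(0 <= i < n.+1) T / n.+1%:R * f (T * (i%:R / n.+1%:R)))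
    @ \oo --> primitive0 f T.
Proof.
move=> T0 cf; apply/cvgrPdist_lt => e e0.
have T1 : 0 < T + 1 by rewrite ltr_wpDl.
have [d d0 H] := unif_cont cf (divr_gt0 e0 T1) T0.
have pf := prim_primitive0 T0 cf.
near=> n.
have n0 : 0 < n.+1%:R :> R by rewrite ltr0n.
have hd : T / n.+1%:R < d.
  rewrite ltr_pdivrMr// mulrC -ltr_pdivrMr//.
  near: n; have [N _ HN] := nbhs_infty_gtr (T / d).
  by exists N => // n /= /HN/lt_trans; apply; rewrite ltr_nat.
pose x i : R := T * (i%:R / n.+1%:R).
have xS i : x i.+1 - x i = T / n.+1%:R.
  by rewrite /x -natr1 !mulrDl mulrDr mul1r addrC addKr.
have -> : primitive0 f T = \sum_(0 <= i < n.+1) (primitive0 f (x i.+1) - primitive0 f (x i)).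
  by rewrite telescope_sumr// /x mul0r mulr0 primitive0_0 subr0 divff ?gt_eqF// mulr1.
rewrite -sumrB (le_lt_trans (ler_norm_sum _ _ _))//.
have dn0 : 0 <= T / n.+1%:R by rewrite divr_ge0.
apply: (@le_lt_trans _ _ (\sum_(0 <= i < n.+1) (T / n.+1%:R * (e / (T + 1))))); last first.
  rewrite sumr_const_nat subn0 -[X in X < _]mulr_natr.
  have -> : T / n.+1%:R * (e / (T + 1)) * n.+1%:R = T * e / (T + 1).
    by field; rewrite !gt_eqF.
  by rewrite ltr_pdivrMr//; nra.
apply: ler_sum_nat => i /andP[_ iN].
have xi0 : 0 <= x i by rewrite mulr_ge0// divr_ge0.
have xSi : x i <= x i.+1 by rewrite -subr_ge0 xS.
have xi1 : x i.+1 <= T.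
  by rewrite /x mulrC ler_piMl// ler_pdivrMr// mul1r ler_nat.
have [r||r] := @MVT_segment R (primitive0 f) f (x i) (x i.+1) xSi.
- rewrite in_itv/= => /andP[r1 r2]; apply: (prim_derive pf).
  by rewrite (le_lt_trans xi0)//= (lt_le_trans r2).
- have [cF _ _] := pf; apply: continuous_subspaceW cF => r /=; rewrite !in_itv/=.
  by move=> /andP[r1 r2]; rewrite (le_trans xi0)//= (le_trans r2).
rewrite in_itv/= => /andP[r1 r2] ->; rewrite xS mulrC -mulrBr normrM ger0_norm//.
rewrite ler_wpM2l// ltW// H//.
- by rewrite (le_trans xi0)//= (le_trans r2).
- by rewrite xi0 (le_trans xSi).
- by rewrite (le_lt_trans _ hd)// ger0_norm ?subr_ge0// -(xS i) lerB.
Unshelve. all: by end_near. Qed.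

End Induction.

(** * Uniform limits *)

Section UniformLimit.
Context {R : realType}.
Implicit Types (T t s e a : R) (f g : R -> R) (F G : nat -> R -> R).

(** [F m] converges to [f] uniformly on [0, T]. *)
Definition unif_lim T F f := forall e : R, 0 < e -> exists N : nat,
  forall m, (N <= m)%N -> forall t, 0 <= t <= T -> `|F m t - f t| <= e.

Lemma unif_lim_cvg T F f t : unif_lim T F f -> 0 <= t <= T ->
  (fun m => F m t) @ \oo --> f t.
Proof.
move=> H tT; apply/cvgrPdist_le => e e0; have [N HN] := H e e0.
by exists N => // m /= Nm; rewrite distrC HN.
Qed.

Lemma unif_lim_cont T F f : (forall m, cont_on T (F m)) -> unif_lim T F f ->
  cont_on T f.
Proof.
move=> cF H; apply/cont_onP => t tT e e0.
have e3 : 0 < e / 3 by rewrite divr_gt0.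
have [N /(_ N (leqnn _)) HN] := H _ e3.
have [d d0 Hd] := (cont_onP _ _).1 (cF N) t tT _ e3.
exists d => // s sT ts; have := Hd s sT ts; have := HN t tT; have := HN s sT.
by rewrite !ler_norml !ltr_norml; lra.
Qed.

Lemma unif_lim_primitive0 T F f t : (forall m, cont_on T (F m)) ->
  unif_lim T F f -> 0 <= t <= T ->
  (fun m => primitive0 (F m) t) @ \oo --> primitive0 f t.
Proof.
move=> cF H /[dup] tT /andP[t0 tT'].
have cf := unif_lim_cont cF H.
apply/cvgrPdist_le => e e0; have t1 : 0 < t + 1 by rewrite ltr_wpDl.
have [N HN] := H _ (divr_gt0 e0 t1).
exists N => // m /= Nm; rewrite distrC.
apply: le_trans (primitive0_dist (cF m) cf tT _) _.
  by move=> s /andP[s0 st]; apply: HN; rewrite // s0 (le_trans st).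
by rewrite mulrAC ler_pdivrMr//; nra.
Qed.

Lemma unif_limD T F f G g : unif_lim T F f -> unif_lim T G g ->
  unif_lim T (fun m t => F m t + G m t) (fun t => f t + g t).
Proof.
move=> HF HG e e0; have e2 : 0 < e / 2 by rewrite divr_gt0.
have [N HN] := HF _ e2; have [M HM] := HG _ e2.
exists (maxn N M) => m; rewrite geq_max => /andP[Nm Mm] t tT.
by have := HN m Nm t tT; have := HM m Mm t tT; rewrite !ler_norml; lra.
Qed.

Lemma unif_limM T F f G g : 0 <= T -> cont_on T f -> cont_on T g ->
  unif_lim T F f -> unif_lim T G g ->
  unif_lim T (fun m t => F m t * G m t) (fun t => f t * g t).
Proof.
move=> T0 cf cg HF HG e e0.
have [A A0 HA] := cont_on_bounded T0 cf; have [B B0 HB] := cont_on_bounded T0 cg.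
have AB0 : 0 < A + B + 1 by rewrite ltr_wpDl// addr_ge0.
have d0 : 0 < Num.min 1 (e / (A + B + 1)) by rewrite lt_min ltr01 divr_gt0.
have [N HN] := HF _ d0; have [M HM] := HG _ d0.
exists (maxn N M) => m; rewrite geq_max => /andP[Nm Mm] t tT.
have := HN m Nm t tT; have := HM m Mm t tT; rewrite !le_min.
move=> /andP[G1 Ge] /andP[F1 Fe].
have -> : F m t * G m t - f t * g t =
  (F m t - f t) * (G m t - g t) + (F m t - f t) * g t + f t * (G m t - g t) by ring.
set E := e / (A + B + 1) in Ge Fe *.
have -> : e = E + E * B + A * E by rewrite /E; field; rewrite gt_eqF.
rewrite (le_trans (ler_normD _ _))// lerD//; last by rewrite normrM ler_pM// HA.
rewrite (le_trans (ler_normD _ _))// lerD//; last by rewrite normrM ler_pM// HB.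
by rewrite normrM -[leRHS]mulr1 ler_pM.
Qed.

Lemma unif_limZ T (a : R) F f : unif_lim T F f ->
  unif_lim T (fun m t => a * F m t) (fun t => a * f t).
Proof.
move=> HF e e0; have a0 : 0 < `|a| + 1 by rewrite ltr_wpDl.
have [N HN] := HF _ (divr_gt0 e0 a0); exists N => m Nm t tT.
rewrite -mulrBr normrM.
have := HN m Nm t tT; rewrite ler_pdivlMr// => H; apply: le_trans H.
by rewrite mulrC ler_wpM2l// lerDl.
Qed.

Lemma unif_cauchy T F (e : nat -> R) N : e @ \oo --> 0 ->
  (forall m n t, (N <= m <= n)%N -> 0 <= t <= T -> `|F n t - F m t| <= e m) ->
  unif_lim T F (fun t => limn (fun m => F m t)).
Proof.
move=> e0 H.
have cvgF t : 0 <= t <= T -> cvgn (fun m => F m t).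
  move=> tT; apply: R_complete; apply: cauchy_exP => r r0.
  have [M _ HM] := (cvgrPdist_lt _ _).1 e0 r r0.
  pose k := maxn N M; exists (F k t); exists k => // n /= kn.
  rewrite /ball/= distrC (le_lt_trans (H _ _ _ _ tT))//; first by rewrite leq_maxl.
  have := HM k (leq_maxr _ _); rewrite /= sub0r normrN.
  exact: le_lt_trans (ler_norm _).
move=> r r0; have [M _ HM] := (cvgrPdist_lt _ _).1 e0 r r0.
exists (maxn N M) => m; rewrite geq_max => /andP[Nm Mm] t tT.
have mr : e m <= r.
  have := HM m Mm; rewrite /= sub0r normrN => /ltW.
  exact: le_trans (ler_norm _).
apply: le_trans mr; rewrite distrC.
have cv : (fun n => `|F n t - F m t|) @ \oo --> `|limn (fun m => F m t) - F m t|.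
  by apply: cvg_norm; apply: cvgB; [exact: cvgF|exact: cvg_cst].
apply: (cvgr_to_le cv); exists m => // n /= mn.
by apply: H => //; rewrite Nm.
Qed.

End UniformLimit.

(** * Algebra of the dyadic vector field *)

Section Algebra.
Context {R : realType}.
Implicit Types (q : R) (x y : nat -> R) (X Y : nat -> R -> R).

(** The drift of the dyadic system with k_j = q^j. *)
Definition vf q x j : R :=
  if j is i.+1 then - (q ^+ j * x j * x j.+1) + q ^+ i * x i ^+ 2
  else - (x 0%N * x 1%N).

Lemma driftE c x j : drift c x j = vf (2 `^ c) x j.
Proof.
have powE i : (2 : R) `^ (c * i%:R) = (2 `^ c) ^+ i.
  by rewrite powRrM powR_mulrn// powR_ge0.
by case: j => [//|j]; rewrite /drift /vf !powE.
Qed.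

(** The nonlinear transfer of energy telescopes. *)
Lemma vf_energy q x n :
  \sum_(1 <= j < n.+1) 2 * x j * vf q x j =
  2 * (x 0%N ^+ 2 * x 1%N) - 2 * (q ^+ n * x n ^+ 2 * x n.+1).
Proof.
elim: n => [|n IH]; first by rewrite big_geq// expr0 mul1r subrr.
by rewrite big_nat_recr//= IH /vf; ring.
Qed.

(** With the weights 2^-j the products z_j z_{j+1} cancel, where z = y - x; the terms
that remain are nonpositive on nonnegative modes, except for the boundary term. *)
Lemma vf_diff q x y n :
  \sum_(0 <= j < n.+1) 2^-1 ^+ j * (2 * (y j - x j) * (vf q y j - vf q x j)) =
  - (\sum_(0 <= j < n.+1) 2^-1 ^+ j * (q ^+ j * (y j - x j) ^+ 2 * (y j.+1 + x j.+1)))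
  - 2^-1 ^+ n * (q ^+ n * (y n ^+ 2 - x n ^+ 2) * (y n.+1 - x n.+1)).
Proof.
elim: n => [|n IH]; first by rewrite !big_nat1 /vf !expr0; ring.
rewrite big_nat_recr// IH [in RHS]big_nat_recr//= /vf.
rewrite !opprD -!addrA; congr (_ + _); rewrite !exprS.
set a := 2^-1 ^+ n; set b := q ^+ n; by field.
Qed.

(** A sequence of at most geometric growth which satisfies the recurrence is bounded
independently of the growth constant [K]: the bound 2 C + 2^-p K q^n is improved
from p to p + 1 by one use of the recurrence. *)
Lemma recurrence_bound q (G : nat -> R) C K l : 1 <= q -> 0 <= C ->
  l = 6 * q ^+ 2 ->
  (forall n, (1 <= n)%N -> G n <= C + (q * G n + G n.+1 + G n.+2) / l) ->
  (forall n, (1 <= n)%N -> G n <= K * q ^+ n) ->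
  forall n, (1 <= n)%N -> G n <= 2 * C.
Proof.
move=> q1 C0 lE rec Kb n n1.
have q0 : 0 < q by rewrite (lt_le_trans ltr01).
have l0 : 0 < l by rewrite lE mulr_gt0// exprn_gt0.
have K0 : 0 <= `|K| by [].
suff H p m : (1 <= m)%N -> G m <= 2 * C + 2^-1 ^+ p * (`|K| * q ^+ m).
  have cv : (fun p => 2 * C + 2^-1 ^+ p * (`|K| * q ^+ n)) @ \oo --> 2 * C + 0 * (`|K| * q ^+ n).
    apply: cvgD; first exact: cvg_cst.
    apply: cvgMl; apply: cvg_expr; rewrite ger0_norm ?invr_ge0//.
    by rewrite invf_lt1 ?ltr1n.
  rewrite mul0r addr0 in cv.
  by apply: (cvgr_to_ge cv); near=> p; exact: H.
elim: p m => [|p IH] m m1.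
  rewrite expr0 mul1r (le_trans (Kb m m1))//.
  by rewrite -[leLHS]add0r lerD ?mulr_ge0// ler_wpM2r ?ler_norm// exprn_ge0// ltW.
apply: (le_trans (rec m m1)).
have h0 := IH m m1; have h1 := IH m.+1 isT; have h2 := IH m.+2 isT.
set a := 2^-1 ^+ p in h0 h1 h2; rewrite !exprS in h1 h2; rewrite exprS -/a.
set b := `|K| * q ^+ m in h0 *.
have a0 : 0 <= a by rewrite exprn_ge0// invr_ge0.
have b0 : 0 <= b by rewrite mulr_ge0// exprn_ge0// ltW.
have ab0 : 0 <= a * b by rewrite mulr_ge0.
rewrite (_ : `|K| * (q * q ^+ m) = q * b) in h1; last by rewrite /b; ring.
rewrite (_ : `|K| * (q * (q * q ^+ m)) = q ^+ 2 * b) in h2; last by rewrite /b; ring.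
have h : (q * G m + G m.+1 + G m.+2) / l <= C + 2^-1 * (a * b).
  rewrite ler_pdivrMr// lE.
  have qq : q <= q ^+ 2 by rewrite expr2 ler_peMl// ltW.
  have hq : q * G m <= q * (2 * C + a * b) by rewrite ler_wpM2l// ltW.
  nra.
lra.
Unshelve. all: by end_near. Qed.

End Algebra.

(** * A priori estimates *)

Lemma young3 (R : realType) (a b : R) : 0 <= a -> 0 <= b ->
  a ^+ 2 * b <= a ^+ 3 + b ^+ 3.
Proof.
move=> a0 b0; have [ab|/ltW ba] := leP a b.
  have : a ^+ 2 * b <= b ^+ 2 * b by rewrite ler_wpM2r// lerXn2r ?nnegrE.
  have : 0 <= a ^+ 3 by rewrite exprn_ge0.
  by rewrite !exprS; lra.
have : a ^+ 2 * b <= a ^+ 2 * a by rewrite ler_wpM2l// sqr_ge0.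
have : 0 <= b ^+ 3 by rewrite exprn_ge0.
by rewrite !exprS; lra.
Qed.

Section Estimates.
Context {R : realType}.
Variables (q T : R).
Hypotheses (q1 : 1 <= q) (T0 : 0 <= T).
Implicit Types (t s : R) (x y : nat -> R) (X Y : nat -> R -> R).

Let q0 : 0 <= q. Proof. by rewrite (le_trans ler01). Qed.
Let qn0 n : 0 <= q ^+ n. Proof. by rewrite exprn_ge0. Qed.

(** [X] is a nonnegative solution of the equations 1, ..., N on [0, T]. The mode 0
need only be continuous, and the modes above N continuous and nonnegative: a solution
of the full system solves all levels, a truncated solution solves its own level. *)
Record solves X N : Prop := {
  solves_cont : forall j, cont_on T (X j) ;
  solves_ge0 : forall j t, (1 <= j)%N -> 0 <= t <= T -> 0 <= X j t ;
  solves_prim : forall j, (1 <= j <= N)%N ->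
    prim T (X j) (fun t => vf q (X^~ t) j) }.

Lemma cont_on_vf X j : (forall i, cont_on T (X i)) ->
  cont_on T (fun t => vf q (X^~ t) j).
Proof.
move=> cX; case: j => [|j]; first by apply: cont_onN; exact: cont_onM.
apply: cont_onD; last by apply: cont_onZ; exact: cont_onX.
by apply: cont_onN; apply: cont_onM => //; exact: cont_onZ.
Qed.

(** A bound of the energy of the modes j >= 1 up to time [T] when the mode 0 is bounded
by [M0] and the initial energy by [E0]. *)
Definition energy_bound (M0 E0 : R) := E0 + 2 * (M0 ^+ 2 * (1 + E0 + M0 ^+ 2 * T) * T).

Lemma energy_bound_ge0 M0 E0 : 0 <= E0 -> 0 <= energy_bound M0 E0.
Proof.
move=> e0; have m0 := sqr_ge0 M0.
by rewrite addr_ge0// mulr_ge0// mulr_ge0// mulr_ge0// !addr_ge0// mulr_ge0.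
Qed.

Section OneSolution.
Variables (X : nat -> R -> R) (N : nat) (M0 E0 : R).
Hypotheses (sX : solves X N) (N1 : (1 <= N)%N).
Hypothesis X0 : forall t, 0 <= t <= T -> `|X 0%N t| <= M0.
Hypothesis XE : \sum_(1 <= j < N.+1) X j 0 ^+ 2 <= E0.

Let cX j : cont_on T (X j). Proof. exact: (solves_cont sX). Qed.
Let Xge0 j t : (1 <= j)%N -> 0 <= t <= T -> 0 <= X j t.
Proof. exact: (solves_ge0 sX). Qed.

Let E := energy_bound M0 E0.

Let E0_ge0 : 0 <= E0.
Proof. by apply: le_trans XE; apply: sumr_ge0 => j _; exact: sqr_ge0. Qed.

Let E_ge0 : 0 <= E. Proof. exact: energy_bound_ge0. Qed.

Lemma first_mode_bound t : 0 <= t <= T -> X 1%N t <= 1 + E0 + M0 ^+ 2 * T.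
Proof.
move=> tT; have /andP[t0 tT'] := tT.
have p1 : prim T (X 1%N) (fun t => vf q (X^~ t) 1) by apply: solves_prim sX _ _; rewrite N1.
apply: le_trans (prim_le p1 (cont_on_cst T (M0 ^+ 2)) tT _) _.
  move=> s /andP[s0 st]; have sT : 0 <= s <= T by rewrite s0 (le_trans st).
  rewrite /vf expr0 mul1r expr1 -[leRHS]add0r lerD//.
    by rewrite oppr_le0 !mulr_ge0 ?Xge0.
  by rewrite -real_normK ?num_real// lerXn2r ?nnegrE// ?X0// (le_trans _ (X0 sT)).
rewrite primitive0_cst// lerD//; last by rewrite ler_wpM2l// sqr_ge0.
have h : X 1%N 0 ^+ 2 <= E0.
  apply: le_trans XE; rewrite big_ltn// lerDl.
  by apply: sumr_ge0 => j _; exact: sqr_ge0.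
by have := sqr_ge0 (X 1%N 0 - 1); nra.
Qed.

Lemma energy_balance n : (n <= N)%N ->
  prim T (fun t => \sum_(1 <= j < n.+1) X j t ^+ 2)
    (fun t => 2 * (X 0%N t ^+ 2 * X 1%N t) - 2 * (q ^+ n * X n t ^+ 2 * X n.+1 t)).
Proof.
move=> nN.
apply: (eq_prim (F := fun t => \sum_(1 <= j < n.+1) X j t ^+ 2)
  (f := fun t => \sum_(1 <= j < n.+1) 2 * X j t * vf q (X^~ t) j)) => //.
  by move=> t _; exact: vf_energy.
apply: prim_sum => j /andP[j1 jn]; apply: prim_sqr.
by apply: solves_prim sX _ _; rewrite j1 (leq_trans _ nN).
Qed.

Lemma cont_on_flux n : cont_on T (fun t => q ^+ n * X n t ^+ 2 * X n.+1 t).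
Proof. by apply: cont_onM => //; apply: cont_onZ; exact: cont_onX. Qed.

(** Energy inequality for the modes 1, ..., n, with the energy lost through the flux from
n to n + 1. *)
Lemma energy_le n t : (n <= N)%N -> 0 <= t <= T ->
  \sum_(1 <= j < n.+1) X j t ^+ 2 +
    2 * primitive0 (fun t => q ^+ n * X n t ^+ 2 * X n.+1 t) t <= E.
Proof.
move=> nN tT; have /andP[t0 tT'] := tT.
have [_ _ /(_ t tT)->] := energy_balance nN.
have c1 : cont_on T (fun t => X 0%N t ^+ 2 * X 1%N t).
  by apply: cont_onM => //; exact: cont_onX.
rewrite (primitive0B (cont_onZ 2 c1) (cont_onZ 2 (@cont_on_flux n)) tT').
rewrite (primitive0Z 2 c1 tT') (primitive0Z 2 (@cont_on_flux n) tT').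
rewrite -addrA subrK lerD//.
  apply: le_trans XE; rewrite [leRHS](@big_cat_nat _ _ _ n.+1)//= lerDl.
  by apply: sumr_ge0 => j _; exact: sqr_ge0.
rewrite ler_pM2l//.
apply: (@le_trans _ _ (M0 ^+ 2 * (1 + E0 + M0 ^+ 2 * T) * t)); last first.
  by rewrite ler_wpM2l// mulr_ge0 ?sqr_ge0// !addr_ge0// mulr_ge0// sqr_ge0.
rewrite -primitive0_cst//; apply: (le_primitive0 c1 (cont_on_cst T _) tT').
move=> s /andP[s0 st]; have sT : 0 <= s <= T by rewrite s0 (le_trans st).
rewrite ler_pM ?sqr_ge0 ?Xge0 ?first_mode_bound//.
by rewrite -real_normK ?num_real// lerXn2r ?nnegrE// ?X0// (le_trans _ (X0 sT)).
Qed.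

Lemma flux_ge0 n t : (1 <= n)%N -> 0 <= t <= T -> 0 <= q ^+ n * X n t ^+ 2 * X n.+1 t.
Proof. by move=> n1 tT; rewrite mulr_ge0 ?Xge0// mulr_ge0// sqr_ge0. Qed.

Lemma energy_sum_le n t : (1 <= n <= N)%N -> 0 <= t <= T ->
  \sum_(1 <= j < n.+1) X j t ^+ 2 <= E.
Proof.
move=> /andP[n1 nN] tT; apply: le_trans (energy_le nN tT).
rewrite lerDl mulr_ge0//; apply: primitive0_ge0 => s /andP[s0 st].
by rewrite flux_ge0// s0 (le_trans st)//; case/andP : tT.
Qed.

Lemma mode_le n t : (1 <= n <= N)%N -> 0 <= t <= T -> X n t ^+ 2 <= E.
Proof.
move=> nN tT; have /andP[n1 _] := nN; apply: le_trans (energy_sum_le nN tT).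
rewrite big_nat_recr//= lerDr.
by apply: sumr_ge0 => j _; exact: sqr_ge0.
Qed.

Lemma flux_le n : (1 <= n <= N)%N ->
  primitive0 (fun t => q ^+ n * X n t ^+ 2 * X n.+1 t) T <= E.
Proof.
move=> /andP[n1 nN]; have TT : 0 <= T <= T by rewrite T0 lexx.
have : 0 <= \sum_(1 <= j < n.+1) X j T ^+ 2.
  by apply: sumr_ge0 => j _; exact: sqr_ge0.
have : 0 <= primitive0 (fun t => q ^+ n * X n t ^+ 2 * X n.+1 t) T.
  by apply: primitive0_ge0 => s sT; exact: flux_ge0.
have := energy_le nN TT; lra.
Qed.

(** The integral of k_n X_n^3 over [0, T]. *)
Definition cubic n : R := primitive0 (fun t => q ^+ n * X n t ^+ 3) T.

Lemma cont_on_cubic n : cont_on T (fun t => q ^+ n * X n t ^+ 3).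
Proof. by apply: cont_onZ; exact: cont_onX. Qed.

Lemma cubic_ge0 n : (1 <= n)%N -> 0 <= cubic n.
Proof.
by move=> n1; apply: primitive0_ge0 => s sT; rewrite mulr_ge0// exprn_ge0// Xge0.
Qed.

Lemma cubic_le n : (1 <= n <= N)%N -> cubic n <= (1 + E) ^+ 3 * T * q ^+ n.
Proof.
move=> nN; have /andP[n1 _] := nN.
rewrite mulrAC [_ * q ^+ n]mulrC -primitive0_cst//.
apply: (le_primitive0 (@cont_on_cubic n) (cont_on_cst T _) (lexx T)) => s sT.
rewrite ler_wpM2l// lerXn2r ?nnegrE ?Xge0 ?(addr_ge0 ler01 E_ge0)//.
by have := mode_le nN sT; have := sqr_ge0 (X n s - 1); nra.
Qed.

(** The integral [P] of the derivative of X_n X_{n+1} is at most [E]. Of its four terms,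
k_n X_n^3 is the one to be bounded, one is dropped by its sign, and Young's
inequality splits the two others between fluxes, with weight [l], and cubes, with
weight 1 / l. *)
Lemma cubic_recurrence l n : 0 < l -> (1 <= n < N)%N ->
  cubic n <= (1 + 2 * l) * E + (q * cubic n + cubic n.+1 + cubic n.+2) / l.
Proof.
move=> l0 /andP[n1 nN].
have TT : 0 <= T <= T by rewrite T0 lexx.
have pn : prim T (X n) (fun t => vf q (X^~ t) n).
  by apply: solves_prim sX _ _; rewrite n1 ltnW.
have pn1 : prim T (X n.+1) (fun t => vf q (X^~ t) n.+1).
  by apply: solves_prim sX _ _; rewrite nN.
have [_ cd HT] := primM pn pn1.
have {HT} := HT T TT.
set P := primitive0 _ T => HT.
have PE : P <= E.
  have : X n T * X n.+1 T <= E.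
    have := energy_sum_le (n := n.+1) _ TT; rewrite nN => /(_ isT).
    rewrite big_nat_recr//= big_nat_recr//= => h.
    have : 0 <= \sum_(1 <= i < n) X i T ^+ 2 by apply: sumr_ge0 => i _; exact: sqr_ge0.
    have := Xge0 n1 TT; have := Xge0 (j := n.+1) isT TT; nra.
  have : 0 <= X n 0 * X n.+1 0 by rewrite mulr_ge0// Xge0// lexx.
  by move: HT; lra.
pose Fl m t := q ^+ m * X m t ^+ 2 * X m.+1 t.
pose Cb m t := q ^+ m * X m t ^+ 3.
have cF m : cont_on T (Fl m) by exact: cont_on_flux.
have cC m : cont_on T (Cb m) by exact: cont_on_cubic.
pose rest t := l * (Fl n t + Fl n.+1 t) + l^-1 * (q * Cb n t + (Cb n.+1 t + Cb n.+2 t)).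
have cFF := cont_onD (cF n) (cF n.+1).
have cCC := cont_onD (cC n.+1) (cC n.+2).
have cCCC := cont_onD (cont_onZ q (cC n)) cCC.
have cr : cont_on T rest by apply: cont_onD; exact: cont_onZ.
have restE : primitive0 rest T = l * (primitive0 (Fl n) T + primitive0 (Fl n.+1) T) +
    l^-1 * (q * cubic n + (cubic n.+1 + cubic n.+2)).
  rewrite (primitive0D (cont_onZ l cFF) (cont_onZ l^-1 cCCC) (lexx T)).
  rewrite (primitive0Z l cFF (lexx T)) (primitive0Z l^-1 cCCC (lexx T)).
  rewrite (primitive0D (cF n) (cF n.+1) (lexx T)).
  rewrite (primitive0D (cont_onZ q (cC n)) cCC (lexx T)).
  by rewrite (primitive0Z q (cC n) (lexx T)) (primitive0D (cC n.+1) (cC n.+2) (lexx T)).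
have key : cubic n <= P + primitive0 rest T.
  rewrite -(primitive0D cd cr (lexx T)).
  apply: (le_primitive0 (cC n) (cont_onD cd cr) (lexx T)) => t tT.
  have a0 := Xge0 n1 tT; have b0 := Xge0 (j := n.+1) isT tT.
  have c0 := Xge0 (j := n.+2) isT tT.
  rewrite /rest /Cb /Fl {cd HT P PE restE}.
  have v : - (q ^+ n * X n t * X n.+1 t) <= vf q (X^~ t) n.
    case: (n) n1 => // m _; rewrite /vf lerDl mulr_ge0//.
    exact: sqr_ge0.
  rewrite [vf q _ n.+1]/vf (exprS q n.+1) (exprS q n).
  have k0 : 0 <= q ^+ n by [].
  move: a0 b0 c0 v; set a := X n t; set b := X n.+1 t; set c := X n.+2 t.
  set k := q ^+ n in k0 *; set w := vf _ _ _ => a0 b0 c0 v.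
  have l1 : l^-1 * l = 1 by rewrite mulVf ?gt_eqF.
  have li : 0 < l^-1 by rewrite invr_gt0.
  set i := l^-1 in l1 li *.
  (* Young: b times (l a - b)^2 >= 0, divided by l *)
  have h1 : k * (a * b ^+ 2) <= k * (l * (a ^+ 2 * b) + i * b ^+ 3).
    rewrite ler_wpM2l//.
    have : 0 <= b * (i * (l * a - b) ^+ 2) by rewrite mulr_ge0// mulr_ge0 ?sqr_ge0// ltW.
    have -> : b * (i * (l * a - b) ^+ 2) =
      (i * l) * (l * (a ^+ 2 * b)) - 2 * (i * l) * (a * b ^+ 2) + i * b ^+ 3 by ring.
    have : 0 <= a * b ^+ 2 by rewrite mulr_ge0// sqr_ge0.
    by rewrite l1; lra.
  (* likewise with c times (l b - a)^2, followed by [young3] *)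
  have h2 : k * q * (a * b * c) <= k * q * (l * (b ^+ 2 * c) + i * (a ^+ 3 + c ^+ 3)).
    rewrite ler_wpM2l ?mulr_ge0//.
    have : 0 <= c * (i * (l * b - a) ^+ 2) by rewrite mulr_ge0// mulr_ge0 ?sqr_ge0// ltW.
    have -> : c * (i * (l * b - a) ^+ 2) =
      (i * l) * (l * (b ^+ 2 * c)) - 2 * (i * l) * (a * b * c) + i * (a ^+ 2 * c) by ring.
    have : i * (a ^+ 2 * c) <= i * (a ^+ 3 + c ^+ 3) by rewrite ler_pM2l// young3.
    have : 0 <= a * b * c by rewrite !mulr_ge0.
    by rewrite l1; lra.
  have h3 : i * k * b ^+ 3 <= i * k * b ^+ 3 * q.
    by rewrite ler_peMr// mulr_ge0 ?exprn_ge0// mulr_ge0// ltW.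
  have h4 : i * k * q * c ^+ 3 <= i * k * q * c ^+ 3 * q.
    by rewrite ler_peMr// mulr_ge0 ?exprn_ge0// mulr_ge0// mulr_ge0// ltW.
  have h5 : - (k * a * b) * b <= w * b by rewrite ler_wpM2r.
  lra.
rewrite mulrC; move: key; rewrite restE.
have := flux_le (n := n) _; rewrite n1 (ltnW nN) => /(_ isT).
have := flux_le (n := n.+1) _; rewrite nN => /(_ isT).
rewrite -/(Fl n) -/(Fl n.+1) => f1 f2.
have : l * (primitive0 (Fl n) T + primitive0 (Fl n.+1) T) <= l * (E + E).
  by rewrite ler_pM2l// lerD.
lra.
Qed.

End OneSolution.

Section Bounds.
Variables (M0 E0 : R).
Hypothesis E0_ge0 : 0 <= E0.
Let E := energy_bound M0 E0.
Let E_ge0 : 0 <= E. Proof. exact: energy_bound_ge0. Qed.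

(** Twice the constant of [cubic_recurrence] for l = 6 q^2. *)
Definition cubic_bound : R := 2 * ((1 + 2 * (6 * q ^+ 2)) * E).

Let l := 6 * q ^+ 2.
Let l_gt0 : 0 < l.
Proof. by rewrite mulr_gt0// exprn_gt0// (lt_le_trans ltr01). Qed.
Let C_ge0 : 0 <= (1 + 2 * l) * E.
Proof. by rewrite mulr_ge0// addr_ge0// mulr_ge0// ltW. Qed.

Lemma cubic_bound_ge0 : 0 <= cubic_bound.
Proof. by rewrite mulr_ge0. Qed.

Lemma cubic_bounded X :
  (forall N, solves X N) ->
  (forall t, 0 <= t <= T -> `|X 0%N t| <= M0) ->
  (forall N, \sum_(1 <= j < N.+1) X j 0 ^+ 2 <= E0) ->
  forall n, (1 <= n)%N -> cubic X n <= cubic_bound.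
Proof.
move=> sX X0 XE; apply: (@recurrence_bound _ q (cubic X) _ ((1 + E) ^+ 3 * T) l) => //.
  move=> n n1; apply: (cubic_recurrence (sX n.+1) _ X0 (XE _)) => //.
  by rewrite n1 /=.
by move=> n n1; apply: (cubic_le (sX n) n1 X0 (XE _)); rewrite n1 /=.
Qed.

(** For a truncated solution with the closure X_{N+1} = X_N, the cube of the last mode
is a flux, hence bounded. Setting G_m = 0 above N + 1 extends the recurrence to all
indices. *)
Lemma cubic_bounded_closed X N : (1 <= N)%N ->
  solves X N -> X N.+1 = X N ->
  (forall t, 0 <= t <= T -> `|X 0%N t| <= M0) ->
  \sum_(1 <= j < N.+1) X j 0 ^+ 2 <= E0 ->
  forall n, (1 <= n <= N.+1)%N -> cubic X n <= cubic_bound.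
Proof.
move=> N1 sX XN X0 XE n /andP[n1 nN].
have CN : cubic X N <= E.
  have := flux_le sX N1 X0 XE (n := N); rewrite N1 leqnn => /(_ isT).
  rewrite (_ : primitive0 _ T = cubic X N)//; apply: eq_primitive0 => t tT.
  by rewrite XN; ring.
have CN1 : cubic X N.+1 = q * cubic X N.
  rewrite -(primitive0Z q (@cont_on_cubic X N sX N) (lexx T)).
  by apply: eq_primitive0 => t tT; rewrite XN exprS mulrA.
pose G m := if (m <= N.+1)%N then cubic X m else 0.
suff : G n <= cubic_bound by rewrite /G nN.
have qq : q <= q ^+ 2 by rewrite expr2 ler_peMl.
have Gge0 m : (1 <= m)%N -> 0 <= G m.
  by move=> m1; rewrite /G; case: ifP => // _; exact: (cubic_ge0 sX).
have K0 m : 0 <= (1 + E) ^+ 3 * T * q ^+ m.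
  by rewrite mulr_ge0// mulr_ge0// exprn_ge0// addr_ge0.
apply: (@recurrence_bound _ q G _ ((1 + E) ^+ 3 * T) l) => //.
  move=> m m1; rewrite -/l.
  have rest0 : 0 <= (q * G m + G m.+1 + G m.+2) / l.
    apply: mulr_ge0; last by rewrite invr_ge0 ltW.
    by rewrite !addr_ge0 ?mulr_ge0 ?Gge0.
  have [mN|] := ltnP m N.
    rewrite /G !ltnS (ltnW mN) mN (leq_trans (ltnW mN))//.
    by apply: (cubic_recurrence sX N1 X0 XE) => //; rewrite m1.
  rewrite leq_eqVlt => /predU1P[Em|].
    move: rest0; rewrite -Em => rest0.
    apply: (le_trans (y := (1 + 2 * l) * E)); last by rewrite lerDl.
    rewrite /G leqnSn (le_trans CN)// mulrDl mul1r lerDl mulr_ge0//.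
    by rewrite mulr_ge0// ltW.
  rewrite leq_eqVlt => /predU1P[Em|mN].
    move: rest0; rewrite -Em => rest0.
    apply: (le_trans (y := (1 + 2 * l) * E)); last by rewrite lerDl.
    rewrite /G leqnn CN1 (le_trans (y := q * E))// ?ler_wpM2l// ler_wpM2r//.
    by rewrite /l; nra.
  rewrite {1}/G leqNgt mN /=; exact: addr_ge0.
move=> m m1; rewrite /G; case: ifP => // mN.
have [mN'|] := leqP m N.
  by apply: (cubic_le sX N1 X0 XE); rewrite m1.
move=> Nm; have -> : m = N.+1 by apply/eqP; rewrite eqn_leq mN Nm.
rewrite CN1 (exprS q N) mulrCA ler_wpM2l//.
by apply: (cubic_le sX N1 X0 XE); rewrite N1 leqnn.
Qed.

End Bounds.

(** Stability in a weak norm: two solutions with the same initial state and the same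
noise differ in the modes up to n only through the boundary term at n. *)
Lemma difference_le X Y N n t : solves X N -> solves Y N -> (1 <= n <= N)%N ->
  (forall j, (j <= N)%N -> X j 0 = Y j 0) ->
  prim T (fun t => Y 0%N t - X 0%N t)
    (fun t => vf q (Y^~ t) 0 - vf q (X^~ t) 0) ->
  0 <= t <= T ->
  \sum_(0 <= j < n.+1) 2^-1 ^+ j * (Y j t - X j t) ^+ 2 <=
  2^-1 ^+ n * (cubic Y n + cubic X n + cubic X n.+1 + cubic Y n.+1).
Proof.
move=> sX sY /andP[n1 nN] XY0 p0 tT; have /andP[t0 tT'] := tT.
have cX j : cont_on T (X j) by exact: (solves_cont sX).
have cY j : cont_on T (Y j) by exact: (solves_cont sY).
have pj j : (j <= N)%N -> prim T (fun t => Y j t - X j t)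
    (fun t => vf q (Y^~ t) j - vf q (X^~ t) j).
  case: j => // j jN; apply: primB; first by apply: (solves_prim sY).
  by apply: (solves_prim sX).
have pS : prim T (fun t => \sum_(0 <= j < n.+1) 2^-1 ^+ j * (Y j t - X j t) ^+ 2)
    (fun t => \sum_(0 <= j < n.+1) 2^-1 ^+ j *
      (2 * (Y j t - X j t) * (vf q (Y^~ t) j - vf q (X^~ t) j))).
  apply: prim_sum => j /andP[_ jn]; apply: primZ; apply: prim_sqr.
  by apply: pj; rewrite (leq_trans _ nN).
pose cb (Z : nat -> R -> R) m t := q ^+ m * Z m t ^+ 3.
have ccX m : cont_on T (cb X m) by exact: cont_on_cubic sX m.
have ccY m : cont_on T (cb Y m) by exact: cont_on_cubic sY m.
have c1 := cont_onD (ccY n) (ccX n).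
have c2 := cont_onD c1 (ccX n.+1).
have c3 := cont_onD c2 (ccY n.+1).
have hp : (0 : R) <= 2^-1 ^+ n by rewrite exprn_ge0// invr_ge0.
apply: le_trans (prim_le pS (cont_onZ (2^-1 ^+ n) c3) tT _) _.
  move=> s /andP[s0 st]; have sT : 0 <= s <= T by rewrite s0 (le_trans st).
  rewrite (vf_diff q (X^~ s) (Y^~ s) n).
  apply: (@le_trans _ _ (- (2^-1 ^+ n * (q ^+ n * (Y n s ^+ 2 - X n s ^+ 2) *
      (Y n.+1 s - X n.+1 s))))).
    rewrite gerDr oppr_le0; apply: sumr_ge0 => j _.
    apply: mulr_ge0; first by rewrite exprn_ge0// invr_ge0.
    apply: mulr_ge0; first by rewrite mulr_ge0// sqr_ge0.
    by rewrite addr_ge0// ?(solves_ge0 sX) ?(solves_ge0 sY).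
  rewrite -mulrN ler_wpM2l// /cb (exprS q n).
  have x1 := solves_ge0 sX (j := n.+1) isT sT.
  have y1 := solves_ge0 sY (j := n.+1) isT sT.
  have x0 := solves_ge0 sX n1 sT; have y0 := solves_ge0 sY n1 sT.
  have := young3 x0 y1; have := young3 y0 x1.
  have := exprn_ge0 3 x0; have := exprn_ge0 3 y0.
  have := mulr_ge0 (exprn_ge0 2 x0) x1; have := mulr_ge0 (exprn_ge0 2 y0) y1.
  have := exprn_ge0 3 x1; have := exprn_ge0 3 y1.
  move: (qn0 n) x0 y0 x1 y1; set k := q ^+ n => k0 x0 y0 x1 y1 x13 y13 xx yy xn yn h1 h2.
  have hx : k * X n.+1 s ^+ 3 <= q * k * X n.+1 s ^+ 3.
    by rewrite ler_wpM2r// ler_peMl.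
  have hy : k * Y n.+1 s ^+ 3 <= q * k * Y n.+1 s ^+ 3.
    by rewrite ler_wpM2r// ler_peMl.
  apply: le_trans (_ : k * (Y n s ^+ 3 + X n s ^+ 3 + X n.+1 s ^+ 3 + Y n.+1 s ^+ 3) <= _).
    by rewrite -mulrA -mulrN ler_wpM2l//; lra.
  lra.
have -> : \sum_(0 <= j < n.+1) 2^-1 ^+ j * (Y j 0 - X j 0) ^+ 2 = 0.
  rewrite big_nat big1// => j /andP[_ jn].
  by rewrite XY0 ?(leq_trans _ nN)// subrr expr0n mulr0.
rewrite add0r (primitive0Z (2^-1 ^+ n) c3 tT') ler_wpM2l//.
have cb0 Z m r : solves Z N -> (1 <= m)%N -> 0 <= r <= T -> 0 <= cb Z m r.
  by move=> sZ m1 rT; rewrite mulr_ge0// exprn_ge0// (solves_ge0 sZ).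
apply: (le_trans (primitive0_nondecreasing c3 t0 tT' (lexx T) _)).
  by move=> r rT; rewrite !addr_ge0// cb0.
rewrite (primitive0D c2 (ccY n.+1) (lexx T)) (primitive0D c1 (ccX n.+1) (lexx T)).
by rewrite (primitive0D (ccY n) (ccX n) (lexx T)).
Qed.

End Estimates.

(** * Pathwise uniqueness *)

Section Uniqueness.
Context {R : realType}.

Lemma l2_partial_sum (v : nat -> R) : l2 v ->
  forall n, \sum_(0 <= j < n) v j ^+ 2 <= limn (series (fun j => v j ^+ 2)).
Proof.
move=> cv n; apply: (nondecreasing_cvgn_le _ cv n).
by apply: nondecreasing_series => j *; exact: sqr_ge0.
Qed.

Lemma bounded_l2 (v : nat -> R) B :
  (forall n, \sum_(0 <= j < n) v j ^+ 2 <= B) -> l2 v.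
Proof.
move=> vB; apply: nondecreasing_is_cvgn.
  by apply: nondecreasing_series => j *; exact: sqr_ge0.
by exists B => _ [n _ <-]; exact: vB.
Qed.

Lemma half_expr_cvg0 : (fun n => 2^-1 ^+ n : R) @ \oo --> 0.
Proof. by apply: cvg_expr; rewrite ger0_norm ?invr_ge0// invf_lt1 ?ltr1n. Qed.

Lemma pathwise_unique (q T : R) (X Y : nat -> R -> R) : 1 <= q -> 0 <= T ->
  (forall N, solves q T X N) -> (forall N, solves q T Y N) ->
  (forall j, X j 0 = Y j 0) -> l2 (X^~ 0) ->
  prim T (fun t => Y 0%N t - X 0%N t)
    (fun t => vf q (Y^~ t) 0 - vf q (X^~ t) 0) ->
  forall j t, 0 <= t <= T -> X j t = Y j t.
Proof.
move=> q1 T0 sX sY XY0 lX p0 j t tT.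
have cX0 : cont_on T (X 0%N) := @solves_cont _ _ _ _ _ (sX 0%N) 0%N.
have cY0 : cont_on T (Y 0%N) := @solves_cont _ _ _ _ _ (sY 0%N) 0%N.
have [MX MX0 XM] := cont_on_bounded T0 cX0.
have [MY MY0 YM] := cont_on_bounded T0 cY0.
pose M0 := MX + MY; pose E0 := limn (series (fun j => X j 0 ^+ 2)).
have XM0 s : 0 <= s <= T -> `|X 0%N s| <= M0.
  by move=> sT; rewrite (le_trans (XM s sT))// lerDl.
have YM0 s : 0 <= s <= T -> `|Y 0%N s| <= M0.
  by move=> sT; rewrite (le_trans (YM s sT))// lerDr.
have XE N : \sum_(1 <= j < N.+1) X j 0 ^+ 2 <= E0.
  apply: le_trans (l2_partial_sum lX N.+1).
  by rewrite [leRHS]big_ltn// lerDr sqr_ge0.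
have YE N : \sum_(1 <= j < N.+1) Y j 0 ^+ 2 <= E0.
  by under eq_bigr do rewrite -XY0; exact: XE.
have E0_ge0 : 0 <= E0 by apply: le_trans (XE 0%N); rewrite big_geq.
pose C := cubic_bound q T M0 E0.
have GX n : (1 <= n)%N -> cubic q T X n <= C by exact: cubic_bounded.
have GY n : (1 <= n)%N -> cubic q T Y n <= C by exact: cubic_bounded.
suff : 2^-1 ^+ j * (Y j t - X j t) ^+ 2 <= 0 * (4 * C).
  rewrite mul0r pmulr_rle0 ?exprn_gt0// => h; apply/eqP; rewrite eq_sym -subr_eq0 -sqrf_eq0.
  by rewrite eq_le h sqr_ge0.
have cv : (fun n => 2^-1 ^+ n * (4 * C)) @ \oo --> 0 * (4 * C).
  by apply: cvgMl; exact: half_expr_cvg0.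
apply: (cvgr_to_ge cv); exists j.+1 => // n /= jn.
have n1 : (1 <= n)%N by rewrite (leq_trans _ jn).
have h := difference_le q1 (sX n) (sY n) (n := n) (t := t).
rewrite n1 leqnn in h.
apply: (le_trans (y := \sum_(0 <= j < n.+1) 2^-1 ^+ j * (Y j t - X j t) ^+ 2)).
  rewrite (bigD1_seq j) ?mem_index_iota ?iota_uniq//= ?lerDl; last by rewrite ltnS ltnW.
  by apply: sumr_ge0 => i _; rewrite mulr_ge0 ?sqr_ge0// exprn_ge0// invr_ge0.
apply: (le_trans (h isT (fun j _ => XY0 j) p0 tT)).
rewrite ler_wpM2l ?exprn_ge0 ?invr_ge0//.
by have := GX n n1; have := GY n n1; have := GX n.+1 isT; have := GY n.+1 isT; lra.
Qed.

End Uniqueness.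

(** * Truncated systems *)

Section Clamp.
Context {R : realType}.
Implicit Types (T : R) (f : R -> R) (h : R -> R) (F : nat -> R -> R).

Lemma cont_on_lip T h f : (forall a b, `|h a - h b| <= `|a - b|) ->
  cont_on T f -> cont_on T (fun t => h (f t)).
Proof.
move=> hl /cont_onP cf; apply/cont_onP => t tT e e0.
have [d d0 H] := cf t tT e e0; exists d => // s sT ts.
by rewrite (le_lt_trans (hl _ _))// H.
Qed.

Lemma unif_lim_lip T h F f : (forall a b, `|h a - h b| <= `|a - b|) ->
  unif_lim T F f -> unif_lim T (fun m t => h (F m t)) (fun t => h (f t)).
Proof.
move=> hl H e e0; have [N HN] := H e e0; exists N => m Nm t tT.
by rewrite (le_trans (hl _ _))// HN.
Qed.

Lemma eq_unif_lim T F f G g : (forall m t, 0 <= t <= T -> F m t = G m t) ->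
  (forall t, 0 <= t <= T -> f t = g t) -> unif_lim T F f -> unif_lim T G g.
Proof.
move=> FG fg H e e0; have [N HN] := H e e0; exists N => m Nm t tT.
by rewrite -FG// -fg// HN.
Qed.

Lemma unif_lim_vf (q T : R) (F : nat -> nat -> R -> R) (f : nat -> R -> R) j :
  0 <= T -> (forall i, cont_on T (f i)) -> (forall i, unif_lim T (F i) (f i)) ->
  unif_lim T (fun m t => vf q (fun i => F i m t) j) (fun t => vf q (f^~ t) j).
Proof.
move=> T0 cf uf; case: j => [|j].
  have := unif_limZ (-1) (unif_limM T0 (cf 0%N) (cf 1%N) (uf 0%N) (uf 1%N)).
  by apply: eq_unif_lim => *; rewrite mulN1r.
have u1 := unif_limM T0 (cf j.+1) (cf j.+2) (uf j.+1) (uf j.+2).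
have u2 := unif_limM T0 (cf j) (cf j) (uf j) (uf j).
have := unif_limD (unif_limZ (- q ^+ j.+1) u1) (unif_limZ (q ^+ j) u2).
by apply: eq_unif_lim => *; rewrite /vf mulNr -mulrA expr2.
Qed.

(** The projection of mode [j] to [-M, M] if j = 0 and to [0, M] otherwise. *)
Definition clamp (M : R) (j : nat) (z : R) : R :=
  Num.max (if j is 0%N then - M else 0) (Num.min M z).

Lemma clamp_lip M j a b : `|clamp M j a - clamp M j b| <= `|a - b|.
Proof.
have h1 := ler_norm (a - b); have := ler_norm (b - a); rewrite distrC => h2.
have h3 := normr_ge0 (a - b).
rewrite /clamp; set c := (if j is 0%N then _ else _); rewrite ler_norml.
by case: (leP M a) => ?; case: (leP M b) => ?;
  [case: (leP c M)|case: (leP c M); case: (leP c b)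
  |case: (leP c a); case: (leP c M)|case: (leP c a); case: (leP c b)] => *; lra.
Qed.

Lemma clamp_norm M j a : 0 <= M -> `|clamp M j a| <= M.
Proof.
move=> M0; rewrite /clamp ler_norml; case: j => [|j];
  case: (leP M a) => ?; rewrite ?(max_idPr M0); try case: (leP (- M) M);
  try case: (leP (- M) a); try case: (leP 0 a); lra.
Qed.

Lemma clamp_ge0 M j a : (1 <= j)%N -> 0 <= clamp M j a.
Proof. by case: j => // j _; rewrite /clamp le_max lexx. Qed.

Lemma clamp_eq0 M j a : (1 <= j)%N -> 0 <= M -> a <= 0 -> clamp M j a = 0.
Proof.
case: j => // j _ M0 a0; rewrite /clamp.
by apply/max_idPl; rewrite ge_min a0 orbT.
Qed.

Lemma clamp_id M j a : (if j is 0%N then - M <= a else 0 <= a) -> a <= M ->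
  clamp M j a = a.
Proof. by move=> h1 h2; rewrite /clamp (min_idPr h2); apply/max_idPr; case: j h1. Qed.

Lemma clamp0_le0 M a : 0 <= M -> a <= 0 -> clamp M 0 a <= 0.
Proof. by move=> M0 a0; rewrite /clamp ge_max oppr_le0 M0/= ge_min a0 orbT. Qed.

Lemma clamp0_ge0 M a : 0 <= M -> 0 <= a -> 0 <= clamp M 0 a.
Proof. by move=> M0 a0; rewrite /clamp le_max le_min M0 a0 orbT. Qed.

End Clamp.

Section Galerkin.
Context {R : realType}.
Variables (q M : R) (N : nat).
Hypotheses (q1 : 1 <= q) (M0 : 0 <= M).
Implicit Types (T t s : R) (v x : nat -> R) (w : R -> R).

Let q0 : 0 <= q. Proof. by rewrite (le_trans ler01). Qed.
Let qn0 n : 0 <= q ^+ n. Proof. by rewrite exprn_ge0. Qed.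

(** The state fed to the vector field in the truncated system: the modes above [N] are
replaced with mode [N], and all modes are clamped. *)
Definition trunc_mode v j : R := clamp M (minn j N) (v (minn j N)).

(** The noise acts on the mode 0 only. *)
Definition noise w j t : R := if j is 0%N then w t else 0.

(** Picard iterates of the truncated clamped system. *)
Fixpoint picard x w m j t : R :=
  if m is m'.+1 then
    x j + noise w j t + primitive0 (fun s => vf q (trunc_mode (fun i => picard x w m' i s)) j) t
  else x j + noise w j t.

(** The solution of the truncated clamped system; the modes above [N] repeat mode [N]. *)
Definition galerkin x w j t : R := limn (fun m => picard x w m (minn j N) t).

Lemma trunc_mode_norm v j : `|trunc_mode v j| <= M.
Proof. exact: clamp_norm. Qed.

Lemma vf_lip_mul (a b a' b' d : R) : `|a| <= M -> `|b'| <= M ->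
  `|a - a'| <= d -> `|b - b'| <= d -> `|a * b - a' * b'| <= 2 * M * d.
Proof.
move=> aM bM ad bd; have -> : a * b - a' * b' = a * (b - b') + (a - a') * b' by ring.
rewrite (le_trans (ler_normD _ _))// -mulrA mulr_natl mulr2n lerD// normrM.
  by rewrite ler_pM.
by rewrite mulrC ler_pM.
Qed.

Let qle i : (i <= N)%N -> q ^+ i <= q ^+ N.
Proof. by move=> iN; rewrite ler_weXn2l. Qed.

(** A Lipschitz constant, for the sup norm over the modes up to [N], of the truncated
clamped vector field; 1 is added to make it positive. *)
Definition lipK : R := 4 * (q ^+ N * M) + 1.

Lemma lipK_gt0 : 0 < lipK.
Proof. by rewrite ltr_wpDl// mulr_ge0// mulr_ge0. Qed.

Lemma vf_trunc_lip v v' j (d : R) : (j <= N)%N -> (forall i, (i <= N)%N -> `|v i - v' i| <= d) ->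
  `|vf q (trunc_mode v) j - vf q (trunc_mode v') j| <= lipK * d.
Proof.
move=> jN vd; have d0 : 0 <= d by exact: le_trans (vd 0%N isT).
have cd i : `|trunc_mode v i - trunc_mode v' i| <= d.
  by rewrite (le_trans (clamp_lip _ _ _ _))// vd// geq_minr.
have mm i k : `|trunc_mode v i * trunc_mode v k - trunc_mode v' i * trunc_mode v' k| <= 2 * M * d.
  by apply: vf_lip_mul => //; exact: trunc_mode_norm.
have Md : 0 <= 2 * M * d by rewrite !mulr_ge0.
have qN1 : 1 <= q ^+ N by rewrite exprn_ege1.
case: j jN => [|j] jN.
  have -> : vf q (trunc_mode v) 0 - vf q (trunc_mode v') 0 =
    - (trunc_mode v 0 * trunc_mode v 1 - trunc_mode v' 0 * trunc_mode v' 1) by rewrite /vf; ring.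
  rewrite normrN (le_trans (mm 0%N 1%N))// /lipK mulrDl mul1r.
  have : 2 * M * d <= q ^+ N * (2 * M * d) by rewrite ler_peMl.
  by move: (mulr_ge0 (qn0 N) Md); lra.
have -> : vf q (trunc_mode v) j.+1 - vf q (trunc_mode v') j.+1 =
    - (q ^+ j.+1 * (trunc_mode v j.+1 * trunc_mode v j.+2 -
        trunc_mode v' j.+1 * trunc_mode v' j.+2)) +
    q ^+ j * (trunc_mode v j * trunc_mode v j - trunc_mode v' j * trunc_mode v' j).
  by rewrite /vf; ring.
rewrite (le_trans (ler_normD _ _))// normrN !normrM !(ger0_norm (qn0 _)).
have h1 : q ^+ j.+1 * `|trunc_mode v j.+1 * trunc_mode v j.+2 -
      trunc_mode v' j.+1 * trunc_mode v' j.+2| <=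
    q ^+ N * (2 * M * d) by rewrite ler_pM ?qle.
have h2 : q ^+ j * `|trunc_mode v j * trunc_mode v j - trunc_mode v' j * trunc_mode v' j| <=
    q ^+ N * (2 * M * d) by rewrite ler_pM ?qle// ltnW.
by rewrite (le_trans (lerD h1 h2))// /lipK; lra.
Qed.

Lemma vf_trunc_bound v j : (j <= N)%N -> `|vf q (trunc_mode v) j| <= 2 * (q ^+ N * M ^+ 2).
Proof.
move=> jN; have mm i k : `|trunc_mode v i * trunc_mode v k| <= M ^+ 2.
  by rewrite normrM expr2 ler_pM ?trunc_mode_norm.
have M2 : 0 <= M ^+ 2 by exact: sqr_ge0.
have qN1 : 1 <= q ^+ N by rewrite exprn_ege1.
have := ler_peMl M2 qN1 => h.
case: j jN => [|j] jN.
  by rewrite /vf normrN (le_trans (mm 0%N 1%N))//; lra.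
rewrite /vf (le_trans (ler_normD _ _))// normrN -mulrA normrM [X in _ + X]normrM.
rewrite !(ger0_norm (qn0 _)) expr2.
have h1 : q ^+ j.+1 * `|trunc_mode v j.+1 * trunc_mode v j.+2| <= q ^+ N * M ^+ 2.
  by rewrite ler_pM ?qle.
have h2 : q ^+ j * `|trunc_mode v j * trunc_mode v j| <= q ^+ N * M ^+ 2.
  by rewrite ler_pM ?qle// ltnW.
lra.
Qed.

Section Path.
Variables (T : R) (x : nat -> R) (w : R -> R).
Hypotheses (T0 : 0 <= T) (cw : cont_on T w).

Lemma cont_on_noise j : cont_on T (noise w j).
Proof. by case: j => [|j]; [exact: cw|exact: cont_on_cst]. Qed.

Lemma cont_on_trunc (V : nat -> R -> R) j : (forall i, (i <= N)%N -> cont_on T (V i)) ->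
  cont_on T (fun t => trunc_mode (V^~ t) j).
Proof.
move=> cV; apply: cont_on_lip; first exact: clamp_lip.
by apply: cV; exact: geq_minr.
Qed.

Lemma cont_on_picard m j : cont_on T (picard x w m j).
Proof.
elim: m j => [|m IH] j.
  by apply: cont_onD; [exact: cont_on_cst|exact: cont_on_noise].
apply: cont_onD; first by apply: cont_onD; [exact: cont_on_cst|exact: cont_on_noise].
apply: cont_on_primitive0 => //; apply: cont_on_vf => i.
by apply: cont_on_trunc => k _; exact: IH.
Qed.

Lemma cont_on_picard_vf m j :
  cont_on T (fun t => vf q (trunc_mode (fun i => picard x w m i t)) j).
Proof.
by apply: cont_on_vf => i; apply: cont_on_trunc => k _; exact: cont_on_picard.
Qed.

Lemma prim_expR (a b : R) : 0 < a ->
  prim T (fun t => b * expR (a * t)) (fun t => a * b * expR (a * t)).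
Proof.
move=> a0.
have ce : cont_on T (fun t => expR (a * t)).
  apply: continuous_subspaceT => t; apply: continuous_comp; last exact: continuous_expR.
  exact: mulrl_continuous.
apply: derive_prim; [exact: cont_onZ|exact: cont_onZ|].
move=> t _; apply: is_derive_eq; rewrite /GRing.scale/=; ring.
Qed.

Let K : R := 2 * (q ^+ N * M ^+ 2) * T.
Let a : R := 2 * lipK.

(** In the weighted norm sup_t exp(-2 L t) |u(t)| the Picard map contracts by 1/2. *)
Lemma picard_cauchy m n j t : (m <= n)%N -> (j <= N)%N -> 0 <= t <= T ->
  `|picard x w n j t - picard x w m j t| <= K * 2^-1 ^+ m * expR (a * t).
Proof.
have a0 : 0 < a by rewrite mulr_gt0// lipK_gt0.
have K0 : 0 <= K by rewrite !mulr_ge0// sqr_ge0.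
elim: m n j t => [|m IH] n j t mn jN /andP[t0 tT].
  have e1 : 1 <= expR (a * t) by rewrite -expR0 ler_expR mulr_ge0// ltW.
  rewrite expr0 mulr1; apply: (@le_trans _ _ K); last by rewrite ler_peMr.
  case: n mn => [|n] _ /=; first by rewrite subrr normr0.
  rewrite addrC addKr.
  have -> : primitive0 (fun s => vf q (trunc_mode (fun i => picard x w n i s)) j) t =
    primitive0 (fun s => vf q (trunc_mode (fun i => picard x w n i s)) j) t -
    primitive0 (fun=> 0) t.
    by rewrite primitive0_cst// mul0r subr0.
  apply: (@le_trans _ _ (2 * (q ^+ N * M ^+ 2) * t)); last first.
    by rewrite ler_wpM2l// mulr_ge0// mulr_ge0// sqr_ge0.
  apply: (primitive0_dist (@cont_on_picard_vf n j) (cont_on_cst T 0)); first by rewrite t0.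
  by move=> s _; rewrite subr0 vf_trunc_bound.
case: n mn => // n mn /=.
rewrite opprD addrACA subrr add0r.
have cn := @cont_on_picard_vf n j; have cm := @cont_on_picard_vf m j.
pose b := K * 2^-1 ^+ m.
have b0 : 0 <= b by rewrite mulr_ge0// exprn_ge0// invr_ge0.
have pE := prim_expR (b / 2) a0; have [_ cE HE] := pE.
apply: (@le_trans _ _ (primitive0 (fun t => a * (b / 2) * expR (a * t)) t)).
  apply: (primitive0_dist_le cn cm cE); first by rewrite t0.
  move=> s /andP[s0 st].
  apply: (@le_trans _ _ (lipK * (b * expR (a * s)))); last first.
    by rewrite /a; lra.
  by apply: vf_trunc_lip => // i iN; apply: IH; rewrite ?s0 ?(le_trans st).
have := HE t; rewrite t0 tT mulr0 expR0 mulr1 => /(_ isT).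
have -> : K * 2^-1 ^+ m.+1 = b / 2 by rewrite /b exprS mulrCA mulrC.
lra.
Qed.

Lemma galerkin_unif_lim j : (j <= N)%N ->
  unif_lim T (fun m => picard x w m j) (galerkin x w j).
Proof.
move=> jN; apply: eq_unif_lim (@unif_cauchy _ T (fun m => picard x w m j)
    (fun m => K * expR (a * T) * 2^-1 ^+ m) 0 _ _) => //.
- by move=> t _; rewrite /galerkin (minn_idPl jN).
- rewrite -[X in _ --> X](mulr0 (K * expR (a * T))); apply: cvgMr; exact: half_expr_cvg0.
move=> m n t mn tT; apply: le_trans (picard_cauchy mn jN tT) _.
have K0 : 0 <= K by rewrite !mulr_ge0// sqr_ge0.
rewrite mulrAC ler_wpM2r ?exprn_ge0 ?invr_ge0// ler_wpM2l// ler_expR.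
by case/andP : tT => _ tT; rewrite ler_wpM2l// ltW// mulr_gt0// lipK_gt0.
Qed.

Lemma galerkin_min j t : galerkin x w j t = galerkin x w (minn j N) t.
Proof. by rewrite /galerkin -minnA minnn. Qed.

Lemma cont_on_galerkin j : cont_on T (galerkin x w j).
Proof.
have -> : galerkin x w j = galerkin x w (minn j N).
  by apply/funext => t; exact: galerkin_min.
apply: (@unif_lim_cont _ _ (fun m => picard x w m (minn j N))).
  by move=> m; exact: cont_on_picard.
by apply: galerkin_unif_lim; exact: geq_minr.
Qed.

Lemma galerkin_eq j t : (j <= N)%N -> 0 <= t <= T ->
  galerkin x w j t = x j + noise w j t +
    primitive0 (fun s => vf q (trunc_mode (galerkin x w ^~ s)) j) t.
Proof.
move=> jN tT.
have h1 := unif_lim_cvg (galerkin_unif_lim jN) tT.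
have h2 : (fun m => picard x w m.+1 j t) @ \oo --> x j + noise w j t +
    primitive0 (fun s => vf q (trunc_mode (galerkin x w ^~ s)) j) t.
  apply: cvgD; first exact: cvg_cst.
  apply: (@unif_lim_primitive0 _ T (fun m s =>
    vf q (trunc_mode (fun i => picard x w m i s)) j)) => //.
    by move=> m; exact: cont_on_picard_vf.
  apply: (@unif_lim_vf _ q T (fun i m s => trunc_mode (fun i => picard x w m i s) i)
     (fun i s => trunc_mode (galerkin x w ^~ s) i)) => // i.
    by apply: cont_on_trunc => k _; exact: cont_on_galerkin.
  apply: unif_lim_lip; first exact: clamp_lip.
  by apply: galerkin_unif_lim; exact: geq_minr.
rewrite -(cvg_shiftS (fun m => picard x w m j t)) in h1.
exact: (cvg_unique _ h1 h2).
Qed.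

End Path.

End Galerkin.

(** * The clamping is inactive for large boxes *)

Section GalerkinSolution.
Context {R : realType}.
Variables (q M T : R) (N : nat) (x : nat -> R) (w : R -> R) (S E0 : R).
Hypotheses (q1 : 1 <= q) (T0 : 0 <= T) (cw : cont_on T w) (w0 : w 0 = 0).
Hypotheses (N1 : (1 <= N)%N) (x_ge0 : forall j, (1 <= j)%N -> 0 <= x j).
Hypothesis xE : \sum_(1 <= j < N.+1) x j ^+ 2 <= E0.
Hypothesis wS : forall t, 0 <= t <= T -> `|w t| <= S.

Let M0 : R := `|x 0%N| + 2 * S.
Let E : R := energy_bound T M0 E0.
Hypotheses (M_ge : M0 <= M) (M_gt : E < M ^+ 2).

Let TT : 0 <= (0:R) <= T. Proof. by rewrite lexx. Qed.
Let S_ge0 : 0 <= S. Proof. by apply: le_trans (wS TT). Qed.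
Let M0_ge0 : 0 <= M0. Proof. by rewrite addr_ge0// mulr_ge0. Qed.
Let M_ge0 : 0 <= M. Proof. exact: le_trans M_ge. Qed.
Let E0_ge0 : 0 <= E0.
Proof. by apply: le_trans xE; apply: sumr_ge0 => j _; exact: sqr_ge0. Qed.

Let U := galerkin q M N x w.

Let cU j : cont_on T (U j). Proof. exact: cont_on_galerkin. Qed.

Let cvfU j : cont_on T (fun s => vf q (trunc_mode M N (U^~ s)) j).
Proof. by apply: cont_on_vf => i; apply: cont_on_trunc. Qed.

Lemma galerkin_0 j : (j <= N)%N -> U j 0 = x j.
Proof.
move=> jN; rewrite /U (galerkin_eq q1 M_ge0 x T0 cw jN TT) primitive0_0 addr0.
by case: j jN => [|j] _ /=; rewrite ?w0 addr0.
Qed.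

Let pU j : (1 <= j <= N)%N -> prim T (U j) (fun s => vf q (trunc_mode M N (U^~ s)) j).
Proof.
case/andP=> j1 jN; split => // t tT; rewrite galerkin_0//.
by rewrite {1}/U (galerkin_eq q1 M_ge0 x T0 cw jN tT); case: j j1 jN => // j _ _; rewrite addr0.
Qed.

Let pU0 : prim T (fun t => U 0%N t - w t) (fun s => vf q (trunc_mode M N (U^~ s)) 0).
Proof.
split => //; first exact: cont_onB.
move=> t tT; rewrite galerkin_0// w0 subr0.
by rewrite {1}/U (galerkin_eq q1 M_ge0 x T0 cw (leq0n N) tT)/= addrAC addrK.
Qed.

Let minN j : (1 <= j)%N -> (1 <= minn j N)%N.
Proof. by move=> j1; rewrite leq_min j1. Qed.

Let trunc_mode_ge0 v j : (1 <= j)%N -> 0 <= trunc_mode M N v j.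
Proof. by move=> j1; exact: clamp_ge0 (minN j1). Qed.

Lemma galerkin_ge0 j t : (1 <= j <= N)%N -> 0 <= t <= T -> 0 <= U j t.
Proof.
move=> jN; have /andP[j1 jN'] := jN.
apply: (barrier (pU jN)); first by rewrite galerkin_0// x_ge0.
move=> s sT Us; case: j j1 jN' jN Us => // j _ jN' jN Us.
have c0 : trunc_mode M N (U^~ s) j.+1 = 0.
  by rewrite /trunc_mode (minn_idPl jN'); apply: clamp_eq0.
rewrite /vf c0 mulr0 mul0r oppr0 add0r.
by apply: mulr_ge0; [rewrite exprn_ge0// (le_trans ler01)|exact: sqr_ge0].
Qed.

(** U_0 - w does not increase while U_0 >= 0 and does not decrease while U_0 <= 0,
because mode 1 is clamped to nonnegative values. *)
Lemma galerkin_mode0 t : 0 <= t <= T -> `|U 0%N t| <= M0.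
Proof.
move=> tT; have c1 s : 0 <= trunc_mode M N (U^~ s) 1 by exact: trunc_mode_ge0.
have wt := wS tT; have nx := ler_norm (x 0%N).
have := ler_norm (- x 0%N); rewrite normrN => nx'.
have lo : - (`|x 0%N| + S) <= U 0%N t - w t.
  apply: (barrier pU0 _ _ tT).
    by have := S_ge0; rewrite galerkin_0// w0 subr0; lra.
  move=> s sT Us; rewrite /vf oppr_ge0 mulr_le0_ge0// /trunc_mode min0n.
  apply: clamp0_le0 => //.
  by have := wS sT; rewrite ler_norml; have := normr_ge0 (x 0%N); lra.
have hi : - (`|x 0%N| + S) <= - 1 * (U 0%N t - w t).
  apply: (barrier (primZ (-1) pU0) _ _ tT).
    by have := S_ge0; rewrite galerkin_0// w0 subr0; lra.
  move=> s sT Us; rewrite /vf mulN1r opprK mulr_ge0// /trunc_mode min0n.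
  apply: clamp0_ge0 => //.
  by have := wS sT; rewrite ler_norml; have := normr_ge0 (x 0%N); lra.
by move: wt; rewrite /M0 !ler_norml; lra.
Qed.

Let X j t := U (minn j N) t.

Let trunc_mode_id s : 0 <= s <= T -> (forall j, (1 <= j <= N)%N -> U j s <= M) ->
  forall j, trunc_mode M N (U^~ s) j = X j s.
Proof.
move=> sT UM j; rewrite /trunc_mode /X; apply: clamp_id.
  case: j => [|j]; last first.
    have : (1 <= minn j.+1 N <= N)%N by rewrite minN// geq_minr.
    by case: (minn _ _) => // i iN; exact: galerkin_ge0.
  have := galerkin_mode0 sT; rewrite min0n ler_norml => /andP[h _].
  by rewrite (le_trans _ h)// lerN2.
case: j => [|j]; last by apply: UM; rewrite minN// geq_minr.
by have := galerkin_mode0 sT; rewrite min0n ler_norml => /andP[_ h]; rewrite (le_trans h).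
Qed.

Let solvesX t : 0 <= t <= T ->
  (forall s, 0 <= s <= t -> forall j, (1 <= j <= N)%N -> U j s <= M) ->
  solves q t X N.
Proof.
move=> /andP[t0 tT] UM; split.
- by move=> j; exact: (cont_onW tT (@cU (minn j N))).
- move=> j s j1 /andP[s0 st]; apply: galerkin_ge0; rewrite ?s0 ?(le_trans st)//.
  by rewrite minN// geq_minr.
move=> j jN; have /andP[_ jN'] := jN.
apply: eq_prim (primW tT (pU jN)) => s /andP[s0 st]; first by rewrite /X (minn_idPl jN').
congr (vf q _ j); apply/funext => i; apply: trunc_mode_id; first by rewrite s0 (le_trans st).
by apply: UM; rewrite s0.
Qed.

(** As long as the energy does not exceed M^2 the clamping is inactive, so that the
energy estimate applies and keeps the energy strictly below M^2. *)
Lemma galerkin_energy_lt t : 0 <= t <= T -> \sum_(1 <= j < N.+1) U j t ^+ 2 < M ^+ 2.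
Proof.
have E0E : E0 <= E.
  rewrite /E /energy_bound lerDl; apply: mulr_ge0 => //; apply: mulr_ge0 => //.
  by apply: mulr_ge0; rewrite ?sqr_ge0// !addr_ge0// mulr_ge0// sqr_ge0.
have sum0 : \sum_(1 <= j < N.+1) U j 0 ^+ 2 <= E0.
  by rewrite (eq_big_nat _ _ (F2 := fun j => x j ^+ 2))// => j /andP[_ jN]; rewrite galerkin_0.
move: t; apply: first_time.
- by apply: cont_on_sum => j _; apply: cont_onX.
- by rewrite (le_lt_trans sum0)// (le_lt_trans E0E).
move=> t tT UM; have /andP[t0 tT'] := tT.
have sX : solves q t X N.
  apply: solvesX => // s st j /andP[j1 jN].
  rewrite -(ler_pXn2r (n := 2)) ?nnegrE//; last first.
    by apply: galerkin_ge0; rewrite ?j1//; case/andP: st => -> /le_trans; apply.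
  apply: le_trans (UM s st).
  rewrite (bigD1_seq j) ?mem_index_iota ?iota_uniq ?j1//= lerDl.
  by apply: sumr_ge0 => i _; exact: sqr_ge0.
have XU s : \sum_(1 <= j < N.+1) X j s ^+ 2 = \sum_(1 <= j < N.+1) U j s ^+ 2.
  by apply: eq_big_nat => j /andP[_]; rewrite ltnS => jN; rewrite /X (minn_idPl jN).
rewrite -XU; apply: le_lt_trans M_gt.
apply: (@le_trans _ _ (energy_bound t M0 E0)).
  apply: (energy_sum_le q1 t0 sX N1); rewrite ?XU ?N1 ?leqnn ?t0 ?lexx//.
  move=> s /andP[s0 st]; rewrite /X min0n; apply: galerkin_mode0.
  by rewrite s0 (le_trans st).
have m0 := sqr_ge0 M0; set m := M0 ^+ 2 in m0 *.
rewrite /E /energy_bound -/m lerD2l ler_pM2l//.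
apply: ler_pM => //; first by rewrite mulr_ge0// !addr_ge0// mulr_ge0.
by rewrite ler_wpM2l// lerD2l ler_wpM2l.
Qed.

Lemma galerkin_le j t : (1 <= j <= N)%N -> 0 <= t <= T -> U j t <= M.
Proof.
move=> jN tT; have /andP[j1 jN'] := jN.
rewrite -(ler_pXn2r (n := 2)) ?nnegrE//; last exact: galerkin_ge0.
apply: le_trans (ltW (galerkin_energy_lt tT)).
rewrite (bigD1_seq j) ?mem_index_iota ?iota_uniq ?j1//= lerDl.
by apply: sumr_ge0 => i _; exact: sqr_ge0.
Qed.

Lemma galerkin_solves : solves q T X N.
Proof.
apply: solvesX; first by rewrite T0 lexx.
by move=> s sT j jN; exact: galerkin_le.
Qed.

Lemma galerkin_solves0 :
  prim T (fun t => X 0%N t - w t) (fun s => vf q (X^~ s) 0).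
Proof.
apply: eq_prim pU0 => s sT; first by rewrite /X min0n.
congr (vf q _ 0); apply/funext => i; apply: trunc_mode_id => // j jN.
exact: galerkin_le.
Qed.

End GalerkinSolution.

(** * Pathwise existence *)

Section PathwiseExistence.
Context {R : realType}.
Variables (q T : R) (x : nat -> R) (w : R -> R).
Hypotheses (q1 : 1 <= q) (T0 : 0 <= T) (cw : cont_on T w) (w0 : w 0 = 0).
Hypothesis xH : Hplus x.

(** The truncated solutions at level [N], with a box of size [N]. *)
Definition galerkin_seq (N : nat) : nat -> R -> R := galerkin q N%:R N x w.

(** The limit of the truncated solutions, mode by mode. *)
Definition limit_sol j t : R := limn (fun N => galerkin_seq N j t).

Lemma galerkin_seq_min N : (fun j t => galerkin_seq N (minn j N) t) = galerkin_seq N.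
Proof. by apply/funext => j; apply/funext => t; rewrite /galerkin_seq [RHS]galerkin_min. Qed.

Lemma cont_on_galerkin_seq N j : cont_on T (galerkin_seq N j).
Proof. exact: cont_on_galerkin. Qed.

(** Beyond some level, which depends on the path, the truncated solutions solve the
unclamped equations and satisfy all the estimates uniformly. *)
Lemma galerkin_seq_props : exists M0 E0 : R, exists2 N0 : nat, (1 <= N0)%N /\ 0 <= E0 &
  forall N, (N0 <= N)%N ->
  [/\ solves q T (galerkin_seq N) N,
      prim T (fun t => galerkin_seq N 0%N t - w t) (fun s => vf q (galerkin_seq N ^~ s) 0),
      forall j, (j <= N)%N -> galerkin_seq N j 0 = x j,
      forall n, (1 <= n <= N)%N -> forall t, 0 <= t <= T ->
        `|galerkin_seq N 0%N t| <= M0 /\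
        \sum_(1 <= j < n.+1) galerkin_seq N j t ^+ 2 <= energy_bound T M0 E0 &
      forall n, (1 <= n <= N.+1)%N -> cubic q T (galerkin_seq N) n <= cubic_bound q T M0 E0].
Proof.
have [lx xge0] := xH.
have [S S0 wS] := cont_on_bounded T0 cw.
pose E0 := limn (series (fun j => x j ^+ 2)).
have xE N : \sum_(1 <= j < N.+1) x j ^+ 2 <= E0.
  apply: le_trans (l2_partial_sum lx N.+1).
  by rewrite [leRHS]big_ltn// lerDr sqr_ge0.
have E0_ge0 : 0 <= E0 by apply: le_trans (xE 0%N); rewrite big_geq.
pose M0 := `|x 0%N| + 2 * S; pose E := energy_bound T M0 E0.
have M0_ge0 : 0 <= M0 by rewrite addr_ge0// mulr_ge0.
have E_ge0 : 0 <= E by exact: energy_bound_ge0.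
have [K _ HK] := nbhs_infty_gtr (M0 + E + 1).
exists M0, E0; exists (maxn 1 K) => [|N]; first by rewrite leq_max.
rewrite geq_max => /andP[N1 /HK KN].
have MN : M0 <= N%:R by move: KN => /=; lra.
have EN : E < N%:R ^+ 2 by move: KN => /=; rewrite expr2; nra.
have sN := galerkin_solves q1 T0 cw w0 N1 xge0 (xE N) wS MN EN.
have pN := galerkin_solves0 q1 T0 cw w0 N1 xge0 (xE N) wS MN EN.
have gN := galerkin_min q N%:R N x w.
rewrite -/(galerkin_seq N) galerkin_seq_min in sN.
have {}pN : prim T (fun t => galerkin_seq N 0%N t - w t) (fun s => vf q (galerkin_seq N ^~ s) 0).
  apply: eq_prim pN => s sT; first by rewrite min0n.
  by congr (vf q _ 0); apply/funext => j; rewrite -galerkin_min.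
have a0 t : 0 <= t <= T -> `|galerkin_seq N 0%N t| <= M0.
  by move=> tT; apply: (galerkin_mode0 q1 T0 cw w0 N1 wS MN).
have ax j : (j <= N)%N -> galerkin_seq N j 0 = x j.
  by move=> jN; exact: (galerkin_0 q1 T0 cw w0 wS MN jN).
have aE : \sum_(1 <= j < N.+1) galerkin_seq N j 0 ^+ 2 <= E0.
  rewrite (eq_big_nat _ _ (F2 := fun j => x j ^+ 2))// => j /andP[_]; rewrite ltnS => jN.
  by rewrite ax.
split => //.
  move=> n nN t tT; split; first exact: a0.
  by apply: (energy_sum_le q1 T0 sN N1 a0 aE).
apply: (cubic_bounded_closed q1 T0 E0_ge0 N1 sN) => //.
by apply/funext => t; rewrite /galerkin_seq galerkin_min [RHS]galerkin_min minnn (minn_idPr _).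
Qed.

Lemma galerkin_seq_cauchy : exists2 N0 : nat, (1 <= N0)%N & exists2 C : R, 0 <= C &
  forall m n j t, (N0 <= m <= n)%N -> (j <= m)%N -> 0 <= t <= T ->
  `|galerkin_seq n j t - galerkin_seq m j t| <= Num.sqrt (2 ^+ j * C * 2^-1 ^+ m).
Proof.
have [M0 [E0 [N0 [N01 E0_ge0] H]]] := galerkin_seq_props.
pose C := 4 * cubic_bound q T M0 E0.
have C0 : 0 <= C by rewrite mulr_ge0// cubic_bound_ge0.
exists N0 => //; exists C => // m n j t /andP[Nm mn] jm tT.
have [sm pm xm _ Cm] := H m Nm.
have [sn pn xn _ Cn] := H n (leq_trans Nm mn).
have m1 : (1 <= m)%N by rewrite (leq_trans N01).
have sn' : solves q T (galerkin_seq n) m.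
  split; [exact: (solves_cont sn)|exact: (solves_ge0 sn)|].
  move=> i /andP[i1 im]; apply: (solves_prim sn).
  by rewrite i1 (leq_trans im).
have p0 : prim T (fun t => galerkin_seq n 0%N t - galerkin_seq m 0%N t)
    (fun t => vf q (galerkin_seq n ^~ t) 0 - vf q (galerkin_seq m ^~ t) 0).
  apply: eq_prim (primB pn pm) => s _ //.
  by rewrite opprB addrA subrK.
have h : 2^-1 ^+ j * (galerkin_seq n j t - galerkin_seq m j t) ^+ 2 <= 2^-1 ^+ m * C.
  apply: (le_trans (y := \sum_(0 <= j < m.+1)
      2^-1 ^+ j * (galerkin_seq n j t - galerkin_seq m j t) ^+ 2)).
    rewrite (bigD1_seq j) ?mem_index_iota ?iota_uniq//= lerDl.
    by apply: sumr_ge0 => i _; rewrite mulr_ge0 ?sqr_ge0// exprn_ge0// invr_ge0.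
  apply: (le_trans (difference_le q1 sm sn' (n := m) _ _ p0 tT)); rewrite ?m1 ?leqnn//.
    by move=> i im; rewrite xm// xn// (leq_trans im).
  rewrite ler_wpM2l ?exprn_ge0 ?invr_ge0// /C.
  have c1 : cubic q T (galerkin_seq m) m <= cubic_bound q T M0 E0 by apply: Cm; rewrite m1 leqnSn.
  have c2 : cubic q T (galerkin_seq m) m.+1 <= cubic_bound q T M0 E0 by apply: Cm; rewrite leqnn.
  have c3 : cubic q T (galerkin_seq n) m <= cubic_bound q T M0 E0.
    by apply: Cn; rewrite m1 (leq_trans mn (leqnSn _)).
  have c4 : cubic q T (galerkin_seq n) m.+1 <= cubic_bound q T M0 E0 by exact: Cn.
  have -> (b : R) : 4 * b = b + b + b + b by ring.
  exact: lerD (lerD (lerD c3 c1) c2) c4.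
rewrite -sqrtr_sqr ler_wsqrtr// -mulrA -ler_pdivrMl ?exprn_gt0//.
by rewrite mulrC -exprVn mulrC [C * _]mulrC.
Qed.

Lemma galerkin_seq_unif_lim j : unif_lim T (fun N => galerkin_seq N j) (limit_sol j).
Proof.
have [N0 N01 [C C0 H]] := galerkin_seq_cauchy.
apply: (@unif_cauchy _ T (fun N => galerkin_seq N j)
  (fun m => Num.sqrt (2 ^+ j * C * 2^-1 ^+ m)) (maxn N0 j)).
  rewrite -[X in _ --> X]sqrtr0 -[X in Num.sqrt X](mulr0 (2 ^+ j * C)).
  apply: continuous_cvg; first exact: sqrt_continuous.
  by apply: cvgMr; exact: half_expr_cvg0.
move=> m n t /andP[]; rewrite geq_max => /andP[Nm jm] mn tT.
by apply: H => //; rewrite Nm.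
Qed.

Lemma cont_on_limit_sol j : cont_on T (limit_sol j).
Proof. exact: unif_lim_cont (@cont_on_galerkin_seq^~ j) (galerkin_seq_unif_lim j). Qed.

Lemma limit_sol_cvg j t : 0 <= t <= T -> (fun N => galerkin_seq N j t) @ \oo --> limit_sol j t.
Proof. exact: unif_lim_cvg (galerkin_seq_unif_lim j). Qed.

Lemma limit_sol_eq j t : 0 <= t <= T ->
  limit_sol j t = x j + noise w j t + primitive0 (fun s => vf q (limit_sol ^~ s) j) t.
Proof.
move=> tT; have h1 := @limit_sol_cvg j t tT.
have uv : unif_lim T (fun N t => vf q (fun i => galerkin_seq N i t) j)
    (fun t => vf q (limit_sol ^~ t) j).
  by apply: (@unif_lim_vf _ q T (fun i N => galerkin_seq N i)) => //;
    [exact: cont_on_limit_sol|exact: galerkin_seq_unif_lim].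
have h2 := @unif_lim_primitive0 _ T _ _ t _ uv tT.
have {}h2 : (fun N => x j + noise w j t + primitive0 (fun s => vf q (galerkin_seq N ^~ s) j) t)
    @ \oo --> x j + noise w j t + primitive0 (fun s => vf q (limit_sol ^~ s) j) t.
  apply: cvgD; first exact: cvg_cst.
  by apply: h2 => N; apply: cont_on_vf => i; exact: cont_on_galerkin_seq.
suff h3 : (fun N => galerkin_seq N j t) @ \oo --> x j + noise w j t +
    primitive0 (fun s => vf q (limit_sol ^~ s) j) t by exact: (cvg_unique _ h1 h3).
apply: cvg_trans h2; apply: near_eq_cvg.
have [M0 [E0 [N0 [N01 _] H]]] := galerkin_seq_props.
exists (maxn N0 j) => // N /=; rewrite geq_max => /andP[NN jN].
have [sN pN xN _ _] := H N NN.
case: j jN {h1 uv} => [|j] jN.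
  have [_ _ /(_ t tT)] := pN; rewrite xN// w0 subr0 => /eqP.
  by rewrite subr_eq => /eqP ->; rewrite /= addrAC.
have [_ _ /(_ t tT)->] := solves_prim sN (j := j.+1) jN.
by rewrite xN//= addr0.
Qed.

Lemma limit_sol_Hplus t : 0 <= t <= T -> Hplus (limit_sol ^~ t).
Proof.
move=> tT; have [M0 [E0 [N0 [N01 E0_ge0] H]]] := galerkin_seq_props.
split; last first.
  move=> j j1; apply: (cvgr_to_ge (@limit_sol_cvg j t tT)).
  exists N0 => // N /= NN; have [sN _ _ _ _] := H N NN.
  exact: (solves_ge0 sN).
apply: (@bounded_l2 _ _ (limit_sol 0%N t ^+ 2 + energy_bound T M0 E0)) => n.
have hn : \sum_(1 <= j < n.+2) limit_sol j t ^+ 2 <= energy_bound T M0 E0.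
  have cv : (fun N => \sum_(1 <= j < n.+2) galerkin_seq N j t ^+ 2) @ \oo -->
      \sum_(1 <= j < n.+2) limit_sol j t ^+ 2.
    apply: cvg_big => [|j _]; first exact: add_continuous.
    by have h := @limit_sol_cvg j t tT; exact: (cvgM h h).
  apply: (cvgr_to_le cv); exists (maxn N0 n.+1) => // N /=.
  rewrite geq_max => /andP[NN nN]; have [_ _ _ EN _] := H N NN.
  by have [|_] := EN n.+1 _ t tT.
apply: (@le_trans _ _ (\sum_(0 <= j < n.+2) limit_sol j t ^+ 2)).
  rewrite [leRHS](@big_cat_nat _ _ _ n)//=; last by rewrite ltnW.
  by rewrite lerDl; apply: sumr_ge0 => i _; exact: sqr_ge0.
by rewrite big_ltn// lerD2l.
Qed.

End PathwiseExistence.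

(** * Measurable dependence on the initial state and the path *)

Section MeasurableSolution.
Context {R : realType} {d : measure_display} {S : measurableType d}.

Notation mfun f := (measurable_fun [set: S] (f : S -> R)).

Lemma measurable_primitive0 (f : R -> S -> R) t : 0 <= t ->
  (forall o, cont_on t (f ^~ o)) -> (forall s, 0 <= s <= t -> mfun (f s)) ->
  mfun (fun o => primitive0 (f ^~ o) t).
Proof.
move=> t0 cf mf.
apply: (measurable_fun_cvg (h := fun n o => \sum_(0 <= i < n.+1)
    t / n.+1%:R * f (t * (i%:R / n.+1%:R)) o)); last first.
  by move=> o _; exact: riemann_sum (cf o).
move=> n; under eq_fun do rewrite big_mkord.
apply: measurable_sum => i; apply: measurable_funM; first exact: measurable_cst.
have n0 : 0 < n.+1%:R :> R by rewrite ltr0n.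
apply: mf; apply/andP; split; first by rewrite mulr_ge0// divr_ge0.
by rewrite ler_piMr// ler_pdivrMr// mul1r ler_nat ltnW.
Qed.

Lemma measurable_vf q (v : S -> nat -> R) j : (forall i, mfun (fun o => v o i)) ->
  mfun (fun o => vf q (v o) j).
Proof.
move=> mv; case: j => [|j] /=.
  apply: measurableT_comp => //; exact: measurable_funM.
apply: measurable_funD.
  apply: measurableT_comp => //; by apply: measurable_funM => //; apply: measurable_funM.
by apply: measurable_funM; [exact: measurable_cst|exact: measurable_funX].
Qed.

Lemma measurable_clamp (M : R) j (v : S -> R) : mfun v -> mfun (fun o => clamp M j (v o)).
Proof.
move=> mv; apply: measurable_maxr; first exact: measurable_cst.
by apply: measurable_minr => //; exact: measurable_cst.
Qed.

(* [S] carries the sigma-algebra of the information available at time [t], for which the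
values of the path at all times s <= t are measurable. *)
Variables (q t : R) (x : S -> nat -> R) (w : S -> R -> R).
Hypotheses (q1 : 1 <= q) (t0 : 0 <= t).
Hypothesis cw : forall o, cont_on t (w o).
Hypothesis mx : forall j, mfun (fun o => x o j).
Hypothesis mw : forall s, 0 <= s <= t -> mfun (fun o => w o s).

Lemma measurable_noise j s : 0 <= s <= t -> mfun (fun o => noise (w o) j s).
Proof. by case: j => [|j] st; [exact: mw|exact: measurable_cst]. Qed.

Lemma measurable_picard M N m j s : 0 <= M -> 0 <= s <= t ->
  mfun (fun o => picard q M N (x o) (w o) m j s).
Proof.
move=> M0; elim: m j s => [|m IH] j s st /=.
  by apply: measurable_funD; [exact: mx|exact: measurable_noise].
apply: measurable_funD; first by apply: measurable_funD; [exact: mx|exact: measurable_noise].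
have /andP[s0 st'] := st.
apply: (measurable_primitive0 (f := fun r o =>
   vf q (trunc_mode M N (fun i => picard q M N (x o) (w o) m i r)) j)) => //.
  by move=> o; apply: cont_on_picard_vf => //; exact: (cont_onW st' (@cw o)).
move=> r /andP[r0 rs]; apply: (@measurable_vf q (fun o i => trunc_mode M N
    (fun i => picard q M N (x o) (w o) m i r) i)) => i.
by apply: measurable_clamp; apply: IH; rewrite r0 (le_trans rs).
Qed.

Lemma measurable_galerkin M N j s : 0 <= M -> 0 <= s <= t ->
  mfun (fun o => galerkin q M N (x o) (w o) j s).
Proof.
move=> M0 st; apply: (measurable_fun_cvg
  (h := fun m o => picard q M N (x o) (w o) m (minn j N) s)).
  by move=> m; exact: measurable_picard.
move=> o _; rewrite galerkin_min.
apply: (@unif_lim_cvg _ t (fun m => picard q M N (x o) (w o) m (minn j N))) => //.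
by apply: galerkin_unif_lim => //; exact: geq_minr.
Qed.

Hypothesis w0 : forall o, w o 0 = 0.
Hypothesis xH : forall o, Hplus (x o).

Lemma measurable_limit_sol j s : 0 <= s <= t ->
  mfun (fun o => limit_sol q (x o) (w o) j s).
Proof.
move=> st; apply: (measurable_fun_cvg
  (h := fun N o => galerkin_seq q (x o) (w o) N j s)).
  by move=> N; apply: measurable_galerkin.
by move=> o _; exact: (limit_sol_cvg q1 t0 (@cw o) (w0 o) (xH o) st).
Qed.

End MeasurableSolution.

(** * Measurability of maps with values in l2 *)

Section L2.
Context {R : realType}.
Implicit Types (u v : nat -> R).

(** The square of the l2 norm; it is meaningful for [v] in l2 only, the limit of a
divergent series being a default value. *)
Definition sqnorm v : R := limn (series (fun j => v j ^+ 2)).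

Lemma sqnorm_ge v n : l2 v -> \sum_(0 <= j < n) v j ^+ 2 <= sqnorm v.
Proof. by move=> lv; exact: l2_partial_sum. Qed.

Lemma sqnorm_le v (B : R) : (forall n, \sum_(0 <= j < n) v j ^+ 2 <= B) -> sqnorm v <= B.
Proof.
move=> vB; apply: limr_le; first exact: bounded_l2 vB.
by near=> n; exact: vB.
Unshelve. all: by end_near. Qed.

Lemma l2_normE v : l2_norm v = Num.sqrt (sqnorm v). Proof. by []. Qed.

Lemma l2_norm_lt v (e : R) : l2 v -> 0 < e -> (l2_norm v < e) = (sqnorm v < e ^+ 2).
Proof.
move=> lv e0; rewrite l2_normE -[RHS](ltr_sqrt _ (exprn_gt0 2 e0)).
by rewrite sqrtr_sqr gtr0_norm.
Qed.

Lemma sqnorm_sub_le u v n : l2 u -> l2 v ->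
  \sum_(0 <= j < n) (u j - v j) ^+ 2 <= 2 * sqnorm u + 2 * sqnorm v.
Proof.
move=> lu lv; apply: (le_trans (y := \sum_(0 <= j < n) (2 * u j ^+ 2 + 2 * v j ^+ 2))).
  by apply: ler_sum => j _; have := sqr_ge0 (u j + v j); nra.
by rewrite big_split/= -!mulr_sumr lerD// ler_pM2l// sqnorm_ge.
Qed.

Lemma l2B u v : l2 u -> l2 v -> l2 (fun j => u j - v j).
Proof. by move=> lu lv; apply: bounded_l2 => n; exact: sqnorm_sub_le. Qed.

Lemma sqnormB_le u v : l2 u -> l2 v ->
  sqnorm (fun j => u j - v j) <= 2 * sqnorm u + 2 * sqnorm v.
Proof. by move=> lu lv; apply: sqnorm_le => n; exact: sqnorm_sub_le. Qed.

Lemma coord_sqnorm v j : l2 v -> v j ^+ 2 <= sqnorm v.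
Proof.
move=> lv; apply: le_trans (sqnorm_ge j.+1 lv).
by rewrite big_nat_recr//= lerDr; apply: sumr_ge0 => i _; exact: sqr_ge0.
Qed.

(** The sequence with the rational entries [p], followed by zeros; these sequences form
a countable dense subset of l2. *)
Definition rat_point (p : seq rat) j : R := ratr (nth 0 p j).

Lemma l2_rat_point p : l2 (rat_point p).
Proof.
apply: (@bounded_l2 _ _ (\sum_(0 <= j < size p) rat_point p j ^+ 2)) => n.
apply: (@le_trans _ _ (\sum_(0 <= j < size p + n) rat_point p j ^+ 2)).
  rewrite [leRHS](@big_cat_nat _ _ _ n)//= ?leq_addl// lerDl.
  by apply: sumr_ge0 => i _; exact: sqr_ge0.
rewrite (@big_cat_nat _ _ _ (size p))//= ?leq_addr//.
rewrite [X in _ + X](_ : _ = 0) ?addr0// big_nat big1// => j /andP[pj _].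
by rewrite /rat_point nth_default// rmorph0 expr0n.
Qed.

Lemma rat_point_dense v (e : R) : l2 v -> 0 < e ->
  exists p, sqnorm (fun j => v j - rat_point p j) < e.
Proof.
move=> lv e0.
have [K _ HK] := (cvgrPdist_lt _ _).1 lv (e / 4) ltac:(by rewrite divr_gt0).
have tail : sqnorm v - \sum_(0 <= j < K) v j ^+ 2 < e / 4.
  have := HK K (leqnn _); rewrite /= /series/= => /(le_lt_trans (ler_norm _)).
  exact.
(* Each of the first [K] coordinates is approximated, with a squared error at most
   [D]; the others are replaced with 0. *)
pose D := e / 4 / K.+1%:R; have D0 : 0 < D by rewrite !divr_gt0.
have dd0 : 0 < Num.min 1 D by rewrite lt_min ltr01.
have /choice[r Hr] : forall j, exists r : rat, (v j - ratr r) ^+ 2 <= D.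
  move=> j; have vd : v j < v j + Num.min 1 D by rewrite ltrDl.
  have [r] := rat_in_itvoo vd; rewrite in_itv/= => /andP[r1 r2]; exists r.
  have h1 : Num.min 1 D <= 1 by rewrite ge_min lexx.
  have h2 : Num.min 1 D <= D by rewrite ge_min lexx orbT.
  rewrite -sqrrN opprB expr2; set z := ratr r - v j.
  have z0 : 0 <= z by rewrite subr_ge0 ltW.
  have zm : z <= Num.min 1 D by rewrite lerBlDl ltW.
  apply: (@le_trans _ _ (z * 1));
    by [rewrite ler_wpM2l// (le_trans zm)|rewrite mulr1 (le_trans zm)].
exists (mkseq r K).
apply: (@le_lt_trans _ _ (e / 2)); last by rewrite ltr_pdivrMr// ltr_pMr// ltr1n.
apply: sqnorm_le => n.
apply: (@le_trans _ _ (\sum_(0 <= j < K + n) (v j - rat_point (mkseq r K) j) ^+ 2)).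
  rewrite [leRHS](@big_cat_nat _ _ _ n)//= ?leq_addl// lerDl.
  by apply: sumr_ge0 => i _; exact: sqr_ge0.
rewrite (@big_cat_nat _ _ _ K)//= ?leq_addr//.
have -> : e / 2 = e / 4 + e / 4 by field.
apply: lerD.
  apply: (@le_trans _ _ (\sum_(0 <= j < K) D)).
    by apply: ler_sum_nat => j /andP[_ jK]; rewrite /rat_point nth_mkseq.
  rewrite sumr_const_nat subn0 -[X in X <= _]mulr_natr.
  apply: (@le_trans _ _ (D * K.+1%:R)); first by rewrite ler_pM2l// ler_nat.
  by rewrite /D divfK.
apply: (le_trans _ (ltW tail)).
rewrite lerBrDl; apply: le_trans (sqnorm_ge (K + n) lv).
rewrite [leRHS](@big_cat_nat _ _ _ K)//= ?leq_addr// lerD2l.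
apply: ler_sum_nat => j /andP[Kj _].
by rewrite /rat_point nth_default ?size_mkseq// rmorph0 subr0.
Qed.

End L2.

Section L2Borel.
Context {R : realType} {d : measure_display} {S : measurableType d}.

Lemma l2_coord_measurable (u : S -> nat -> R) j :
  (forall o, l2 (u o)) ->
  (forall A, l2_borel R A -> measurable (u @^-1` A)) ->
  measurable_fun [set: S] (fun o => u o j).
Proof.
move=> lu mu; apply: (measurability _ (RGenOInfty.measurableE R)).
move=> _ [_ [a ->] <-]; rewrite setTI.
have -> : (fun o => u o j) @^-1` `]a, +oo[ = u @^-1` [set v | l2 v /\ a < v j].
  apply/seteqP; split => o /=; rewrite in_itv/= andbT; last by move=> [].
  by split.
apply: mu; apply: sub_sigma_algebra; split; first by move=> v [].
move=> v [lv av]; exists (v j - a); first by rewrite subr_gt0.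
move=> v' lv' vv'; split => //.
have lB := l2B lv' lv.
move: vv'; rewrite l2_norm_lt ?subr_gt0// => h.
have := le_lt_trans (coord_sqnorm j lB) h.
rewrite ltNge => /negP; rewrite ltNge => H; apply/negP => v'a; apply: H.
by have := av; nra.
Qed.

Lemma measurable_sqnorm (u : S -> nat -> R) : (forall o, l2 (u o)) ->
  (forall j, measurable_fun [set: S] (fun o => u o j)) ->
  measurable_fun [set: S] (fun o => sqnorm (u o)).
Proof.
move=> lu mu; apply: (measurable_fun_cvg (h := fun n o => \sum_(0 <= j < n) u o j ^+ 2)).
  by move=> n; apply: measurable_sum => j; exact: measurable_funX.
by move=> o _; exact: lu.
Qed.

(** An open set of l2 is the union of the balls of radius 1 / (n + 1) with rational
centre [p] that it contains, and such balls are described by the coordinates. *)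
Lemma measurable_l2_borel (u : S -> nat -> R) : (forall o, l2 (u o)) ->
  (forall j, measurable_fun [set: S] (fun o => u o j)) ->
  forall A, l2_borel R A -> measurable (u @^-1` A).
Proof.
move=> lu mu A; apply: (@smallest_sub _ _ _ [set A | measurable (u @^-1` A)]).
  split => /=.
  - by rewrite preimage_set0; exact: measurable0.
  - move=> B mB; have -> : u @^-1` (l2 (R:=R) `\` B) = ~` (u @^-1` B).
      by apply/seteqP; split => o /= => [[]//|nB]; split.
    exact: measurableC.
  - by move=> B mB; rewrite preimage_bigcup; exact: bigcup_measurable.
move=> {}A [Al2 openA] /=.
pose ball p n v := sqnorm (fun j => v j - rat_point p j) < n.+1%:R^-1 ^+ 2 :> R.
pose good p n := forall v, l2 v -> ball p n v -> A v.
have -> : u @^-1` A = \bigcup_(pn : seq rat * nat)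
    [set o | good pn.1 pn.2 /\ ball pn.1 pn.2 (u o)].
  apply/seteqP; split => o /=; last by move=> [[p n] _ /= [g b]]; exact: g.
  move=> Ao; have [e e0 He] := openA _ Ao.
  have [n _ Hn] := nbhs_infty_gtr (2 / e).
  have {Hn} := Hn n (leqnn _) => /= hn.
  have ne : 2 * n.+1%:R^-1 < e.
    rewrite ltr_pdivrMr// mulrC -ltr_pdivrMr//.
    by rewrite (lt_trans hn)// ltr_nat.
  have i0 : 0 < n.+1%:R^-1 :> R by rewrite invr_gt0.
  have [p Hp] := rat_point_dense (lu o) (exprn_gt0 2 i0).
  exists (p, n) => //=; split => // v lv bv.
  apply: He => //; rewrite l2_norm_lt//; last exact: l2B.
  have lp := @l2_rat_point R p.
  apply: (@le_lt_trans _ _ (2 * sqnorm (fun j => v j - rat_point p j) +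
       2 * sqnorm (fun j => u o j - rat_point p j))).
    have := sqnormB_le (l2B lv lp) (l2B (lu o) lp).
    rewrite (_ : (fun j => _ - _) = (fun j => v j - u o j))//.
    by apply/funext => j; rewrite opprB addrA subrK.
  have h : (2 * n.+1%:R^-1) ^+ 2 < e ^+ 2 by rewrite ltrXn2r// ?nnegrE ltW// mulr_gt0.
  move: bv Hp h; rewrite /ball; move: (n.+1%:R^-1) (sqnorm _) (sqnorm _) => i a b.
  by nra.
apply: countable_bigcupT_measurable; first exact: countableP.
move=> [p n] /=; have [g|ng] := pselect (good p n); last first.
  rewrite (_ : [set _ | _] = set0); first exact: measurable0.
  by rewrite -subset0 => o /= [].
rewrite (_ : [set _ | _] = [set o | ball p n (u o)]); last first.
  by apply/seteqP; split => o /= => [[]|].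
have mb : measurable_fun [set: S] (fun o => sqnorm (fun j => u o j - rat_point p j)).
  apply: (measurable_sqnorm (u := fun o j => u o j - rat_point p j)).
    by move=> o; apply: l2B => //; exact: l2_rat_point.
  by move=> j; apply: measurable_funB => //; exact: measurable_cst.
have := mb measurableT _ (measurable_itv `]-oo, (n.+1%:R^-1 ^+ 2 : R)[).
rewrite setTI; congr measurable; apply/seteqP; split => o /=; rewrite in_itv//=.
Qed.

End L2Borel.

(** * Strong solutions *)

Section StrongSolutions.
Variables (R : realType) (T sigma c : R).
Hypotheses (T0 : 0 <= T) (c0 : 0 <= c).
Variables (d : measure_display) (Omega : measurableType d) (P : probability Omega R).
Variables (W : R -> Omega -> R) (u0 : Omega -> nat -> R).
Hypothesis u0H : forall o, Hplus (u0 o).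

Let q : R := 2 `^ c.

Let q1 : 1 <= q.
Proof. by rewrite -(powRr0 2) ler_powR// ler1n. Qed.

Let primitive0_drift (v : R -> nat -> R) j t :
  \int[lebesgue_measure]_(s in `[0, t]) drift c (v s) j = primitive0 (fun s => vf q (v s) j) t.
Proof. by apply: eq_Rintegral => s _; rewrite driftE. Qed.

Lemma strong_solution_unique u1 u2 :
  strong_solution P T sigma c W u0 u1 -> strong_solution P T sigma c W u0 u2 ->
  {ae P, forall w, forall t : R, 0 <= t <= T -> u1 t w = u2 t w}.
Proof.
move=> s1 s2; apply: filterS2 (sol_system s1) (sol_system s2).
move=> o [u10 eq1] [u20 eq2] t tT; apply/funext => j.
have c1 i : cont_on T (fun t => u1 t o i) by exact: (sol_continuous s1).
have c2 i : cont_on T (fun t => u2 t o i) by exact: (sol_continuous s2).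
have cv1 i : cont_on T (fun t => vf q (u1 t o) i) by exact: (cont_on_vf c1).
have cv2 i : cont_on T (fun t => vf q (u2 t o) i) by exact: (cont_on_vf c2).
pose X i t := u1 t o i; pose Y i t := u2 t o i.
have sX N : solves q T X N.
  split => //.
    by move=> i s i1 sT; have [_] := sol_Hplus s1 o sT; exact.
  move=> i /andP[i1 _]; split; [exact: c1|exact: cv1|] => s sT.
  by have [_ /(_ i i1)] := eq1 s sT; rewrite primitive0_drift.
have sY N : solves q T Y N.
  split => //.
    by move=> i s i1 sT; have [_] := sol_Hplus s2 o sT; exact.
  move=> i /andP[i1 _]; split; [exact: c2|exact: cv2|] => s sT.
  by have [_ /(_ i i1)] := eq2 s sT; rewrite primitive0_drift.
have TT : 0 <= (0 : R) <= T by rewrite lexx.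
apply: (@pathwise_unique _ q T X Y) => //.
- by move=> i; rewrite /X /Y u10 u20.
- by have [] := sol_Hplus s1 o TT.
split; [exact: (cont_onB (c2 0%N) (c1 0%N))|exact: (cont_onB (cv2 0%N) (cv1 0%N))|].
move=> s sT; have /andP[_ sT'] := sT.
rewrite (primitive0B (cv2 0%N) (cv1 0%N) sT').
have [h1 _] := eq1 s sT; have [h2 _] := eq2 s sT.
move: h1 h2; rewrite !primitive0_drift /X /Y u10 u20 => -> ->.
by rewrite subrr add0r; ring.
Qed.

Hypothesis cW : forall o, {within `[0, T], continuous (fun t => W t o)}.

Let noise_path o t := sigma * (W t o - W 0 o).

(** The solution driven by the path sigma (W(t) - W(0)). Subtracting W(0), which vanishes
almost surely only, makes the construction work for every sample point. *)
Definition strong_sol t o j : R := limit_sol q (u0 o) (noise_path o) j t.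

Let noise_path0 o : noise_path o 0 = 0.
Proof. by rewrite /noise_path subrr mulr0. Qed.

Let cont_on_noise_path o : cont_on T (noise_path o).
Proof. by apply: cont_onZ; apply: cont_onB; [exact: cW|exact: cont_on_cst]. Qed.

Lemma strong_sol_adapted t : 0 <= t <= T ->
  measurable_wrt (generated_filtration W u0 t) (l2_borel R) (strong_sol t).
Proof.
move=> /andP[t0 tT].
rewrite /generated_filtration; set D := (D in <<s D >>).
pose S := g_sigma_algebraType D.
have mW s : 0 <= s <= t -> measurable_fun [set: S] (W s : S -> R).
  move=> st _ B mB; apply: sub_sigma_algebra; right; exists s; first by rewrite /= in_itv.
  by exists B.
have mu0 j : measurable_fun [set: S] ((fun o => u0 o j) : S -> R).
  apply: l2_coord_measurable; first by move=> o; have [] := u0H o.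
  move=> A bA; apply: sub_sigma_algebra; left; exists A => //.
  by rewrite setTI.
apply: (@measurable_l2_borel R _ S (strong_sol t)).
  move=> o; have tT' : 0 <= t <= T by rewrite t0.
  have cn := @cont_on_noise_path o.
  by have [] := limit_sol_Hplus q1 T0 cn (noise_path0 o) (u0H o) tT'.
move=> j; apply: (@measurable_limit_sol R _ S q t u0 noise_path) => //.
- by move=> o; exact: (cont_onW tT (@cont_on_noise_path o)).
- move=> s st; apply: measurable_funM; first exact: measurable_cst.
  by apply: measurable_funB; apply: mW; rewrite ?lexx.
by rewrite t0 lexx.
Qed.

Lemma strong_sol_is_solution : {ae P, forall w, W 0 w = 0} ->
  strong_solution P T sigma c W u0 strong_sol.
Proof.
have TT : 0 <= (0 : R) <= T by rewrite lexx.
move=> W0; split.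
- move=> o t tT; exact: (limit_sol_Hplus q1 T0 (@cont_on_noise_path o) (noise_path0 o) (u0H o) tT).
- move=> o j; exact: (cont_on_limit_sol q1 T0 (@cont_on_noise_path o) (noise_path0 o) (u0H o)).
- exact: strong_sol_adapted.
apply: filterS W0 => o W0.
have eqs j t : 0 <= t <= T -> strong_sol t o j = u0 o j + noise (noise_path o) j t +
    primitive0 (fun s => vf q (strong_sol s o) j) t.
  move=> tT.
  exact: (limit_sol_eq q1 T0 (@cont_on_noise_path o) (noise_path0 o) (u0H o) j tT).
have init j : strong_sol 0 o j = u0 o j.
  rewrite eqs// primitive0_0 addr0.
  by case: j => [|j] /=; rewrite ?noise_path0 addr0.
split; first by apply/funext.
move=> t tT; split=> [|j j1]; rewrite primitive0_drift init [LHS]eqs//.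
  have -> : noise (noise_path o) 0 t = sigma * W t o.
    by rewrite /noise /noise_path W0 subr0.
  exact: addrAC.
by case: j j1 => // j _ /=; rewrite addr0.
Qed.

End StrongSolutions.

Unset Implicit Arguments.

Theorem theorem3p1 (R : realType) (T sigma c : R)
  (hT : 0 <= T) (hsigma : 0 <= sigma) (hc : 1 <= c < 3)
  (d : measure_display) (Omega : measurableType d) (P : probability Omega R)
  (F : R -> set (set Omega)) (hF : is_filtration T F)
  (W : R -> Omega -> R) (hW : is_brownian_motion P T F W)
  (u0 : Omega -> nat -> R) (hu0 : forall w, Hplus (u0 w))
  (hu0F : measurable_wrt (F 0) (l2_borel R) u0) :
  (exists u : R -> Omega -> nat -> R, strong_solution P T sigma c W u0 u) /\
  (forall u1 u2 : R -> Omega -> nat -> R,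
     strong_solution P T sigma c W u0 u1 ->
     strong_solution P T sigma c W u0 u2 ->
     {ae P, forall w, forall t : R, 0 <= t <= T -> u1 t w = u2 t w}).
Proof.
have c0 : 0 <= c by case/andP: hc => /(le_trans ler01).
split; last by move=> u1 u2; exact: strong_solution_unique.
exists (strong_sol sigma c W u0); apply: strong_sol_is_solution => //.
- exact: bm_continuous hW.
- exact: bm_start hW.
Qed.
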